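(* Let $(M,\lambda,J)$ be a contact triad, let $(\dot\Sigma,j)$ be a (possibly punctured) Riemann surface, and let $w:\dot\Sigma\to M$ be a contact Cauchy--Riemann map, i.e. a smooth map with $\overline{\partial}^\pi w=0$. Then, as $w^*\xi$-valued $2$-forms on $\dot\Sigma$, $$ d^{\nabla^\pi}(d^\pi w) = -(w^*\lambda\circ j) \wedge\left( \tfrac{1}{2}(\mathcal{L}_{X_\lambda}J)\, d^\pi w\right). $$
   Context: Contact triad: $M$ is a smooth $(2n+1)$-dimensional manifold with a co-oriented contact structure $\xi=\ker\lambda$, where $\lambda$ is a contact form. The Reeb vector field $X_\lambda$ is defined by $\lambda(X_\lambda)=1$, $X_\lambda\rfloor d\lambda=0$. $J:\xi\to\xi$ is an endomorphism with $J^2=-\mathrm{id}$, compatible with $d\lambda$ in the sense that $g_\xi=d\lambda(\cdot,J\cdot)$ makes $(\xi,J,g_\xi)$ a Hermitian vector bundle; $J$ is extended to $TM$ by $JX_\lambda=0$. The triple $(M,\lambda,J)$ is called a contact triad and $M$ carries the triad metric $g=g_\xi+\lambda\otimes\lambda$. $\pi:TM\to\xi$ is the projection along $X_\lambda$; $\mathcal{L}$ is the Lie derivative. Contact triad connection: $\nabla$ denotes the unique affine connection on $M$ (its existence and uniqueness are known) with torsion $T(X,Y)=\nabla_XY-\nabla_YX-[X,Y]$ such that: (1) $\nabla g=0$; (2) $T(X_\lambda,\cdot)=0$; (3) $\nabla_{X_\lambda}X_\lambda=0$ and $\nabla_YX_\lambda\in\xi$ for $Y\in\xi$; (4) $\nabla^\pi:=\pi\nabla|_\xi$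 is a Hermitian connection on $(\xi,d\lambda|_\xi,J)$; (5) $T^\pi:=\pi T$ satisfies $T^\pi(JY,Y)=0$ for all $Y\in\xi$; (6) $\nabla_YX_\lambda-J\nabla_{JY}X_\lambda=0$ for $Y\in\xi$. For a smooth map $w:\dot\Sigma\to M$: $d^\pi w:=\pi\, dw$ is a $w^*\xi$-valued $1$-form on $\dot\Sigma$, and $\overline{\partial}^\pi w=\frac12(\pi dw+J\pi dw\circ j)$, $\partial^\pi w=\frac12(\pi dw-J\pi dw\circ j)$. The pull-back of $\nabla^\pi$ to $w^*\xi$ is also denoted $\nabla^\pi$, and $d^{\nabla^\pi}$ is the induced exterior covariant derivative on $w^*\xi$-valued forms, $d^{\nabla^\pi}(\alpha\otimes\zeta)=d\alpha\otimes\zeta+(-1)^k\alpha\wedge\nabla^\pi\zeta$ for a $k$-form $\alpha$. The wedge of a real $1$-form $\alpha$ and a vector-valued $1$-form $\beta$ is $(\alpha\wedge\beta)(v_1,v_2)=\alpha(v_1)\beta(v_2)-\alpha(v_2)\beta(v_1)$. *)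

(* Defs.v *)
From HB Require Import structures.
From mathcomp Require Import all_boot all_order all_algebra all_fingroup.
From mathcomp Require Import all_classical all_reals all_analysis.
Set Implicit Arguments.
Unset Strict Implicit.
Unset Printing Implicit Defensive.
Import Order.TTheory GRing.Theory Num.Theory numFieldNormedType.Exports.
Local Open Scope classical_set_scope.
Local Open Scope ring_scope.

(* C^k and C^oo maps on an open subset U of R^m. *)
Fixpoint Ck_on (R : realType) (m : nat) (W : normedModType R) (k : nat)
    (U : set 'rV[R]_m) (f : 'rV[R]_m -> W) : Prop :=
  match k with
  | 0 => forall x, U x -> {for x, continuous f}
  | k'.+1 => (forall x, U x -> differentiable f x) /\
      forall v : 'rV[R]_m, Ck_on k' U (fun x => 'd f x v)
  end.

Definition smooth_on (R : realType) (m : nat) (W : normedModType R)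
    (U : set 'rV[R]_m) (f : 'rV[R]_m -> W) : Prop :=
  forall k, Ck_on k U f.

Definition smooth_at (R : realType) (m : nat) (W : normedModType R)
    (f : 'rV[R]_m -> W) (x : 'rV[R]_m) : Prop :=
  exists U : set 'rV[R]_m, [/\ open U, U x & smooth_on U f].

(* Smooth m-manifolds. The atlas is indexed by the points of M: every point p
   has a preferred chart [chart p], defined on the open set [dom p] around p,
   with inverse [chartV p]. Outside [dom p] (resp. its image) the total functions
   [chart p] (resp. [chartV p]) carry no information.

   The tangent space at p is R^m, a vector being identified with its components
   in the preferred chart [chart p] of its base point. A vector field is thus a
   function M -> 'rV[R]_m, and a section of f^*TM, for f : B -> M, is a function
   B -> 'rV[R]_m; comparing vectors at different points goes through
   [to_chart] and [coord_field] below. *)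
Record manifold (R : realType) (m : nat) := Manifold {
  carrier :> topologicalType;
  dom : carrier -> set carrier;
  chart : carrier -> carrier -> 'rV[R]_m;
  chartV : carrier -> 'rV[R]_m -> carrier;
  manifold_hausdorff : hausdorff_space carrier;
  manifold_second_countable : @second_countable carrier;
  dom_open : forall p, open (dom p);
  dom_base : forall p, dom p p;
  chart_open : forall p, open (chart p @` dom p);
  chartK : forall p q, dom p q -> chartV p (chart p q) = q;
  chart_continuous : forall p q, dom p q -> {for q, continuous (chart p)};
  chartV_continuous : forall p x, (chart p @` dom p) x ->
    {for x, continuous (chartV p)};
  chart_compat : forall p q,
    smooth_on (chart p @` (dom p `&` dom q)) (chart q \o chartV p)
}.

(* Components in [chart p] of the tangent vector v at q, for q in [dom p]. *)
Definition to_chart (R : realType) (m : nat) (M : manifold R m) (p q : M)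
    (v : 'rV[R]_m) : 'rV[R]_m :=
  'd (chart p \o chartV q) (chart q q) v.

(* The vector field on [dom p] with constant components v in [chart p]. *)
Definition coord_field (R : realType) (m : nat) (M : manifold R m) (p : M)
    (v : 'rV[R]_m) (q : M) : 'rV[R]_m :=
  'd (chart q \o chartV p) (chart p q) v.

Definition fun_smooth_at (R : realType) (m : nat) (M : manifold R m)
    (W : normedModType R) (f : M -> W) (p : M) : Prop :=
  smooth_at (f \o chartV p) (chart p p).

Definition dfun (R : realType) (m : nat) (M : manifold R m)
    (W : normedModType R) (f : M -> W) (p : M) (v : 'rV[R]_m) : W :=
  'd (f \o chartV p) (chart p p) v.

Definition smooth_map (R : realType) (k m : nat) (B : manifold R k)
    (M : manifold R m) (f : B -> M) : Prop :=
  continuous f /\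
  forall b, smooth_at (chart (f b) \o f \o chartV b) (chart b b).

Definition dmap (R : realType) (k m : nat) (B : manifold R k)
    (M : manifold R m) (f : B -> M) (b : B) (v : 'rV[R]_k) : 'rV[R]_m :=
  'd (chart (f b) \o f \o chartV b) (chart b b) v.

(* Coordinate expression near b of a section s of f^*TM, in [chart b] on B and
   [chart (f b)] on M. *)
Definition local_rep (R : realType) (k m : nat) (B : manifold R k)
    (M : manifold R m) (f : B -> M) (s : B -> 'rV[R]_m) (b : B) :
    'rV[R]_k -> 'rV[R]_m :=
  fun x => to_chart (f b) (f (chartV b x)) (s (chartV b x)).

(* s is, on a neighbourhood of b, a smooth section of f^*E, where E is a
   subbundle of TM. *)
Definition section_at (R : realType) (k m : nat) (B : manifold R k)
    (M : manifold R m) (f : B -> M) (E : M -> set 'rV[R]_m)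
    (s : B -> 'rV[R]_m) (b : B) : Prop :=
  smooth_at (local_rep f s b) (chart b b) /\
  \forall b' \near b, E (f b') (s b').

Definition TM (R : realType) (m : nat) (M : manifold R m) : M -> set 'rV[R]_m :=
  fun=> setT.

(* Vector fields are the sections of id^*TM. *)
Definition vfield_at (R : realType) (m : nat) (M : manifold R m)
    (Y : M -> 'rV[R]_m) (p : M) : Prop :=
  section_at id (@TM R m M) Y p.

Definition bracket (R : realType) (m : nat) (M : manifold R m)
    (X Y : M -> 'rV[R]_m) (p : M) : 'rV[R]_m :=
  'd (local_rep id Y p) (chart p p) (X p) -
  'd (local_rep id X p) (chart p p) (Y p).

Definition linear_fiberwise (R : realType) (m : nat) (M : manifold R m)
    (W : lmodType R) (a : M -> 'rV[R]_m -> W) : Prop :=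
  forall p, linear (a p).

Definition form1_at (R : realType) (m : nat) (M : manifold R m)
    (a : M -> 'rV[R]_m -> R^o) (p : M) : Prop :=
  forall v, fun_smooth_at (fun q => a q (coord_field p v q)) p.

Definition endo (R : realType) (m : nat) (M : manifold R m)
    (A : M -> 'rV[R]_m -> 'rV[R]_m) : Prop :=
  linear_fiberwise A /\
  forall p v, vfield_at (fun q => A q (coord_field p v q)) p.

(* d a (u, v) = U (a V) - V (a U) - a [U, V], evaluated on the commuting fields
   with constant components u, v in [chart p]. *)
Definition extd (R : realType) (m : nat) (M : manifold R m)
    (a : M -> 'rV[R]_m -> R^o) (p : M) (u v : 'rV[R]_m) : R :=
  dfun (fun q => a q (coord_field p v q)) p u -
  dfun (fun q => a q (coord_field p u q)) p v.

(* (L_X A) V = [X, A V] - A [X, V], with V extending v constantly in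
   [chart p]; the value at p does not depend on the extension. *)
Definition lie_endo (R : realType) (m : nat) (M : manifold R m)
    (X : M -> 'rV[R]_m) (A : M -> 'rV[R]_m -> 'rV[R]_m) (p : M)
    (v : 'rV[R]_m) : 'rV[R]_m :=
  bracket X (fun q => A q (coord_field p v q)) p -
  A p (bracket X (coord_field p v) p).

Definition wedge (R : realType) (k : nat) (W : lmodType R)
    (a : 'rV[R]_k -> R) (b : 'rV[R]_k -> W) (v1 v2 : 'rV[R]_k) : W :=
  a v1 *: b v2 - a v2 *: b v1.

(* A connection on f^*E, E a subbundle of TM: D s b v is the covariant derivative
   of s at b in the direction v. It acts on sections defined and smooth near b
   (extended by arbitrary values elsewhere). *)
Definition connection (R : realType) (k m : nat) (B : manifold R k)
    (M : manifold R m) (f : B -> M) (E : M -> set 'rV[R]_m)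
    (D : (B -> 'rV[R]_m) -> B -> 'rV[R]_k -> 'rV[R]_m) : Prop :=
  [/\ forall s b, section_at f E s b -> linear (D s b),
      forall s t b, section_at f E s b -> section_at f E t b ->
        forall v, D (fun b' => s b' + t b') b v = D s b v + D t b v,
      forall (h : B -> R^o) s b, fun_smooth_at h b -> section_at f E s b ->
        forall v, D (fun b' => h b' *: s b') b v
                  = dfun h b v *: s b + h b *: D s b v &
      forall s (V : B -> 'rV[R]_k) b, section_at f E s b -> vfield_at V b ->
        section_at f E (fun b' => D s b' (V b')) b].

Definition affine_connection (R : realType) (m : nat) (M : manifold R m)
    (nabla : (M -> 'rV[R]_m) -> M -> 'rV[R]_m -> 'rV[R]_m) : Prop :=
  connection id (@TM R m M) nabla.

Definition torsion (R : realType) (m : nat) (M : manifold R m)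
    (nabla : (M -> 'rV[R]_m) -> M -> 'rV[R]_m -> 'rV[R]_m)
    (Y Z : M -> 'rV[R]_m) (p : M) : 'rV[R]_m :=
  nabla Z p (Y p) - nabla Y p (Z p) - bracket Y Z p.

(* D is the pull-back by f of the connection nabla on E. *)
Definition pullback_connection (R : realType) (k m : nat) (B : manifold R k)
    (M : manifold R m) (f : B -> M) (E : M -> set 'rV[R]_m)
    (nabla : (M -> 'rV[R]_m) -> M -> 'rV[R]_m -> 'rV[R]_m)
    (D : (B -> 'rV[R]_m) -> B -> 'rV[R]_k -> 'rV[R]_m) : Prop :=
  connection f E D /\
  forall Y b v, section_at id E Y (f b) ->
    D (fun b' => Y (f b')) b v = nabla Y (f b) (dmap f b v).

(* f^*E-valued 1-forms on B, smooth near b. *)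
Definition vform1_at (R : realType) (k m : nat) (B : manifold R k)
    (M : manifold R m) (f : B -> M) (E : M -> set 'rV[R]_m)
    (beta : B -> 'rV[R]_k -> 'rV[R]_m) (b : B) : Prop :=
  linear_fiberwise beta /\
  forall v, section_at f E (fun b' => beta b' (coord_field b v b')) b.

(* dD is the exterior covariant derivative induced by D on f^*E-valued 1-forms:
   it is additive and dD (a (x) s) = da (x) s - a /\ D s. These rules determine
   dD since every 1-form is locally a finite sum of such products. *)
Definition ext_cov_derivative (R : realType) (k m : nat) (B : manifold R k)
    (M : manifold R m) (f : B -> M) (E : M -> set 'rV[R]_m)
    (D : (B -> 'rV[R]_m) -> B -> 'rV[R]_k -> 'rV[R]_m)
    (dD : (B -> 'rV[R]_k -> 'rV[R]_m) -> B -> 'rV[R]_k -> 'rV[R]_k ->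
          'rV[R]_m) : Prop :=
  (forall beta gamma b, vform1_at f E beta b -> vform1_at f E gamma b ->
     forall v1 v2, dD (fun b' v => beta b' v + gamma b' v) b v1 v2
                   = dD beta b v1 v2 + dD gamma b v1 v2) /\
  (forall (a : B -> 'rV[R]_k -> R^o) s b,
     linear_fiberwise a -> form1_at a b -> section_at f E s b ->
     forall v1 v2, dD (fun b' v => a b' v *: s b') b v1 v2
                   = extd a b v1 v2 *: s b - wedge (a b) (D s b) v1 v2).

(* The last clause says that lam /\ (d lam)^n is nowhere zero: up to a positive
   factor, the sum is its value on the standard basis of the tangent space. *)
Definition contact_form (R : realType) (n : nat) (M : manifold R n.*2.+1)
    (lam : M -> 'rV[R]_(n.*2.+1) -> R^o) : Prop :=
  [/\ linear_fiberwise lam,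
      forall p, form1_at lam p &
      forall p, let e i : 'rV[R]_(n.*2.+1) := delta_mx 0 i in
        \sum_(s : 'S_(n.*2.+1)) (-1) ^+ s * lam p (e (s ord0)) *
          \prod_(i < n) extd lam p (e (s (inord i.*2.+1)))
                                   (e (s (inord i.*2.+2))) != 0 :> R].

Definition contact_str (R : realType) (m : nat) (M : manifold R m)
    (lam : M -> 'rV[R]_m -> R^o) : M -> set 'rV[R]_m :=
  fun p => [set v | lam p v = 0].

Definition reeb_field (R : realType) (m : nat) (M : manifold R m)
    (lam : M -> 'rV[R]_m -> R^o) (X : M -> 'rV[R]_m) : Prop :=
  [/\ forall p, vfield_at X p,
      forall p, lam p (X p) = 1 &
      forall p v, extd lam p (X p) v = 0].

Definition proj_xi (R : realType) (m : nat) (M : manifold R m)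
    (lam : M -> 'rV[R]_m -> R^o) (X : M -> 'rV[R]_m) (p : M)
    (v : 'rV[R]_m) : 'rV[R]_m :=
  v - lam p v *: X p.

Definition metric_xi (R : realType) (m : nat) (M : manifold R m)
    (lam : M -> 'rV[R]_m -> R^o) (J : M -> 'rV[R]_m -> 'rV[R]_m) (p : M)
    (u v : 'rV[R]_m) : R :=
  extd lam p u (J p v).

Definition triad_metric (R : realType) (m : nat) (M : manifold R m)
    (lam : M -> 'rV[R]_m -> R^o) (X : M -> 'rV[R]_m)
    (J : M -> 'rV[R]_m -> 'rV[R]_m) (p : M) (u v : 'rV[R]_m) : R :=
  metric_xi lam J p (proj_xi lam X p u) (proj_xi lam X p v) +
  lam p u * lam p v.

(* J is a complex structure on xi, extended by J X = 0, such that (xi, J, g_xi)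
   is a Hermitian vector bundle. *)
Definition compatible_acs (R : realType) (m : nat) (M : manifold R m)
    (lam : M -> 'rV[R]_m -> R^o) (X : M -> 'rV[R]_m)
    (J : M -> 'rV[R]_m -> 'rV[R]_m) : Prop :=
  let xi := contact_str lam in
  let g := metric_xi lam J in
  [/\ endo J,
      forall p, J p (X p) = 0,
      forall p v, xi p v -> xi p (J p v) /\ J p (J p v) = - v,
      forall p u v, xi p u -> xi p v ->
        g p u v = g p v u /\ g p (J p u) (J p v) = g p u v &
      forall p v, xi p v -> v != 0 -> 0 < g p v v].

Definition contact_triad (R : realType) (n : nat) (M : manifold R n.*2.+1)
    (lam : M -> 'rV[R]_(n.*2.+1) -> R^o) (X : M -> 'rV[R]_(n.*2.+1))
    (J : M -> 'rV[R]_(n.*2.+1) -> 'rV[R]_(n.*2.+1)) : Prop :=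
  [/\ contact_form lam, reeb_field lam X & compatible_acs lam X J].

Definition nabla_pi (R : realType) (m : nat) (M : manifold R m)
    (lam : M -> 'rV[R]_m -> R^o) (X : M -> 'rV[R]_m)
    (nabla : (M -> 'rV[R]_m) -> M -> 'rV[R]_m -> 'rV[R]_m) :
    (M -> 'rV[R]_m) -> M -> 'rV[R]_m -> 'rV[R]_m :=
  fun Y p v => proj_xi lam X p (nabla Y p v).

Definition metric_connection (R : realType) (m : nat) (M : manifold R m)
    (E : M -> set 'rV[R]_m) (g : M -> 'rV[R]_m -> 'rV[R]_m -> R)
    (nabla : (M -> 'rV[R]_m) -> M -> 'rV[R]_m -> 'rV[R]_m) : Prop :=
  forall Y Z p v, section_at id E Y p -> section_at id E Z p ->
    dfun (fun q => g q (Y q) (Z q) : R^o) p v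
    = g p (nabla Y p v) (Z p) + g p (Y p) (nabla Z p v).

Definition hermitian_connection (R : realType) (m : nat) (M : manifold R m)
    (E : M -> set 'rV[R]_m) (g : M -> 'rV[R]_m -> 'rV[R]_m -> R)
    (J : M -> 'rV[R]_m -> 'rV[R]_m)
    (nabla : (M -> 'rV[R]_m) -> M -> 'rV[R]_m -> 'rV[R]_m) : Prop :=
  [/\ connection id E nabla,
      metric_connection E g nabla &
      forall Y p v, section_at id E Y p ->
        nabla (fun q => J q (Y q)) p v = J p (nabla Y p v)].

Record contact_triad_connection (R : realType) (m : nat) (M : manifold R m)
    (lam : M -> 'rV[R]_m -> R^o) (X : M -> 'rV[R]_m)
    (J : M -> 'rV[R]_m -> 'rV[R]_m)
    (nabla : (M -> 'rV[R]_m) -> M -> 'rV[R]_m -> 'rV[R]_m) : Prop := {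
  ctc_affine : affine_connection nabla;
  ctc_metric : metric_connection (@TM R m M) (triad_metric lam X J) nabla;
  ctc_torsion_reeb : forall Y p, vfield_at Y p -> torsion nabla X Y p = 0;
  ctc_reeb_reeb : forall p, nabla X p (X p) = 0;
  ctc_reeb_xi : forall p v, contact_str lam p v ->
    contact_str lam p (nabla X p v);
  ctc_hermitian : hermitian_connection (contact_str lam) (metric_xi lam J) J
    (nabla_pi lam X nabla);
  ctc_torsion_xi : forall Y p, section_at id (contact_str lam) Y p ->
    proj_xi lam X p (torsion nabla (fun q => J q (Y q)) Y p) = 0;
  ctc_reeb_J : forall p v, contact_str lam p v ->
    nabla X p v - J p (nabla X p (J p v)) = 0
}.

(* A Riemann surface is a surface S with a complex structure j on TS. *)
Definition riemann_surface (R : realType) (S : manifold R 2)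
    (j : S -> 'rV[R]_2 -> 'rV[R]_2) : Prop :=
  endo j /\ forall z v, j z (j z v) = - v.

Definition dpi (R : realType) (k m : nat) (S : manifold R k) (M : manifold R m)
    (lam : M -> 'rV[R]_m -> R^o) (X : M -> 'rV[R]_m) (w : S -> M) (z : S)
    (v : 'rV[R]_k) : 'rV[R]_m :=
  proj_xi lam X (w z) (dmap w z v).

Definition dbar_pi (R : realType) (k m : nat) (S : manifold R k)
    (M : manifold R m) (lam : M -> 'rV[R]_m -> R^o) (X : M -> 'rV[R]_m)
    (J : M -> 'rV[R]_m -> 'rV[R]_m) (j : S -> 'rV[R]_k -> 'rV[R]_k)
    (w : S -> M) (z : S) (v : 'rV[R]_k) : 'rV[R]_m :=
  2^-1 *: (dpi lam X w z v + J (w z) (dpi lam X w z (j z v))).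

Definition contact_CR_map (R : realType) (k m : nat) (S : manifold R k)
    (M : manifold R m) (lam : M -> 'rV[R]_m -> R^o) (X : M -> 'rV[R]_m)
    (J : M -> 'rV[R]_m -> 'rV[R]_m) (j : S -> 'rV[R]_k -> 'rV[R]_k)
    (w : S -> M) : Prop :=
  smooth_map w /\ forall z v, dbar_pi lam X J j w z v = 0.

Definition pullback_form (R : realType) (k m : nat) (S : manifold R k)
    (M : manifold R m) (w : S -> M) (a : M -> 'rV[R]_m -> R^o) (z : S)
    (v : 'rV[R]_k) : R^o :=
  a (w z) (dmap w z v).

(* Main.v *)
(* On vector fields Y, Z the torsion is G(Y, Z) - G(Z, Y), where
   G(u, v) = nabla_u v with v extended constantly in a chart.  Pulling the
   frame pi(e_i) of xi back by w, and writing d^pi w as the sum of the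
   dw^i (x) pi(e_i), the symmetry of the second derivatives of w kills the
   d(dw^i) terms and leaves
     pi T(dw v1, dw v2) - lam(dw v2) nabla_{dw v1} X + lam(dw v1) nabla_{dw v2} X.
   As S is a surface it suffices to take v2 = j v1.  Then pi dw v2 = J pi dw v1, so
   the torsion term vanishes, and the axioms on nabla X together with
   T(X, -) = 0 give (1/2) (L_X J) Y = J nabla_Y X, which turns the other two terms
   into the right-hand side. *)
From HB Require Import structures.
Require Import Defs.
From mathcomp Require Import all_boot all_order all_algebra.
From mathcomp Require Import all_classical all_reals all_analysis.
From mathcomp Require Import ring.
Import GRing.Theory Num.Theory numFieldNormedType.Exports.
Local Open Scope ring_scope.
Set Implicit Arguments.
Unset Strict Implicit.
Unset Printing Implicit Defensive.
Import Order.TTheory.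
Local Open Scope classical_set_scope.

(** [nabla], [D] and [dD] are known only through their rules (additivity, Leibniz), and they take
    functions on the whole of [M] or [S]. That their values depend only on germs is not one of these
    rules. Every expansion in a frame is therefore arranged as an identity at all points, with chart
    frames prolonged off the chart domain. Testing on v2 = j v1 suffices because both sides are
    alternating and j has no real eigenvalue: for v nonzero, v and j v span the plane. One point
    about L_X J is hidden: the derivative along X must commute with J, while the Hermitian axiom
    controls only the pi-part on sections of xi. Metric compatibility and nabla_X X = 0 supply the
    rest, since they make nabla_X preserve xi. *)

(** * Differentials: dependence on germs, chain rule, product rule *)

Lemma near_eq_diff (R : realType) (V W : normedModType R) (f g : V -> W) (x : V) :
  (\near x, f x = g x) -> differentiable f x ->
  differentiable g x /\ 'd g x = 'd f x :> (V -> W).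
Proof.
move=> fg df; have fgx := nbhs_singleton fg.
have H : g \o shift x = cst (g x) + 'd f x +o_ 0 id.
  apply/eqaddoP => e e0; rewrite /= -fgx.
  have /eqaddoP /(_ _ e0) := diff_locally df.
  have : \forall h \near 0, f (h + x) = g (h + x).
    by move: fg; rewrite (near_shift 0) /=; apply: filterS => h; rewrite /= subr0.
  by apply: filterS2 => h Hh; rewrite /= !fctE /= Hh.
have D : 'd g x = 'd f x :> (V -> W) by apply: diff_unique => //; exact: diff_continuous.
by split=> //; apply/diff_locallyP; split; rewrite D //; exact: diff_continuous.
Qed.

Lemma near_eq_diffE (R : realType) (V W : normedModType R) (f g : V -> W)
    (x v : V) : (\near x, f x = g x) -> differentiable f x ->
  'd g x v = 'd f x v.
Proof. by move=> fg df; have [_ E] := near_eq_diff fg df; rewrite E. Qed.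

Lemma diff_compE (R : realType) (U V W : normedModType R) (f : U -> V)
    (g : V -> W) (x v : U) : differentiable f x -> differentiable g (f x) ->
  'd (g \o f) x v = 'd g (f x) ('d f x v).
Proof. by move=> df dg; rewrite (diff_comp df dg). Qed.

Section ScaleBilinear.
Variables (R : realType) (W : normedModType R).

(** Scaling is declared as a bilinear map so that the product rule below is the differential of a
    continuous bilinear map composed with the pairing of [h] and [f]. *)
Let scale (a : R^o) (u : W) : W := a *: u.

Let scale_is_bilinear : bilinear_for
    (GRing.Scale.Law.clone _ _ *:%R _) (GRing.Scale.Law.clone _ _ *:%R _) scale.
Proof.
split=> [u'|u] a x y /=; first by rewrite /scale scalerDl scalerA.
by rewrite /scale scalerDr !scalerA mulrC.
Qed.

HB.instance Definition _ :=
  bilinear_isBilinear.Build R R^o W W _ _ scale scale_is_bilinear.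

Lemma is_diff_scale (V : normedModType R) (h : V -> R^o) (f : V -> W) x :
  differentiable h x -> differentiable f x ->
  is_diff x (fun y => h y *: f y)
    (fun v => h x *: 'd f x v + 'd h x v *: f x).
Proof.
move=> dh df.
have cs : continuous (fun p : R^o * W => scale p.1 p.2).
  by move=> p; exact: scale_continuous.
have -> : (fun y => h y *: f y) =
  (fun p : R^o * W => scale p.1 p.2) \o (fun y => (h y, f y)) by [].
have dp := differentiable_pair dh df.
have ds : differentiable (fun p : R^o * W => scale p.1 p.2) (h x, f x).
  exact: differentiable_bilin.
apply: DiffDef; first exact: differentiable_comp.
by rewrite diff_comp// diff_bilin//= diff_pair.
Qed.
End ScaleBilinear.

(** * Calculus of C^k maps on open subsets of R^m *)

Section Ck.
Variables (R : realType) (m : nat).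
Implicit Types (W : normedModType R) (U : set 'rV[R]_m).

Lemma eq_Ck_on W k U (f g : 'rV[R]_m -> W) : open U ->
  (forall x, U x -> f x = g x) -> Ck_on k U f -> Ck_on k U g.
Proof.
move=> oU; elim: k f g => [|k IH] f g fg /=.
  move=> cf x Ux; have Un : \forall y \near x, f y = g y.
    by apply: filterS (open_nbhs_nbhs (conj oU Ux)) => y /fg.
  have := cf x Ux; rewrite /prop_for /continuous_at (fg x Ux).
  by apply: cvg_trans; apply: (near_eq_cvg Un).
case=> df Ck; have E x : U x ->
    differentiable g x /\ 'd g x = 'd f x :> ('rV[R]_m -> W).
  move=> Ux; apply: near_eq_diff; last exact: df.
  by apply: filterS (open_nbhs_nbhs (conj oU Ux)) => y /fg.
split=> [x Ux|v]; first by case: (E x Ux).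
apply: (IH _ _ _ (Ck v)) => x Ux.
by have [_ Ex] := E x Ux; exact: esym (congr1 (@^~ v) Ex).
Qed.

Lemma subset_Ck_on W k U V (f : 'rV[R]_m -> W) :
  V `<=` U -> Ck_on k U f -> Ck_on k V f.
Proof.
move=> VU; elim: k f => [|k IH] f /=; first by move=> H x /VU /H.
by case=> df Ck; split=> [x /VU /df//|v]; exact: IH.
Qed.

Lemma Ck_onW W k U (f : 'rV[R]_m -> W) : Ck_on k.+1 U f -> Ck_on k U f.
Proof.
elim: k f => [|k IH] f; first by case=> df _ x /df /differentiable_continuous.
by case=> df Ck; split=> // v; apply/IH/Ck.
Qed.

Lemma Ck_on_cst W k U (c : W) : Ck_on k U (fun=> c).
Proof.
elim: k c => [|k IH] c /=; first by move=> x _; exact: cst_continuous.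
split=> [x _|v]; first exact: differentiable_cst.
by rewrite (_ : (fun _ => _) = fun=> 0)//; apply/funext => x; rewrite diff_cst.
Qed.

Lemma Ck_onD W k U (f g : 'rV[R]_m -> W) : open U ->
  Ck_on k U f -> Ck_on k U g -> Ck_on k U (fun x => f x + g x).
Proof.
move=> oU; elim: k f g => [|k IH] f g /=.
  by move=> cf cg x Ux; exact: (cvgD (cf x Ux) (cg x Ux)).
move=> [df Cf] [dg Cg]; split=> [x Ux|v].
  exact: (differentiableD (df x Ux) (dg x Ux)).
apply: (eq_Ck_on oU _ (IH _ _ (Cf v) (Cg v))) => x Ux.
exact: esym (congr1 (@^~ v) (diffD (df x Ux) (dg x Ux))).
Qed.

(** The derivative of a product mixes one differentiated factor with one that is not; [Ck_onW]
    lowers the order of the latter so that the induction hypothesis applies to both summands. *)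
Lemma Ck_onZ W k U (h : 'rV[R]_m -> R^o) (f : 'rV[R]_m -> W) : open U ->
  Ck_on k U h -> Ck_on k U f -> Ck_on k U (fun x => h x *: f x).
Proof.
move=> oU; elim: k h f => [|k IH] h f.
  by move=> ch cf x Ux; exact: (cvgZ (ch x Ux) (cf x Ux)).
move=> Ch Cf; have [dh Ch'] := Ch; have [df Cf'] := Cf.
split=> [x Ux|v].
  by have [] := is_diff_scale (dh x Ux) (df x Ux).
apply: (eq_Ck_on oU _ (Ck_onD oU (IH _ _ (Ck_onW Ch) (Cf' v))
                          (IH _ _ (Ch' v) (Ck_onW Cf)))) => x Ux.
have [_ E] := is_diff_scale (dh x Ux) (df x Ux).
exact: esym (congr1 (@^~ v) E).
Qed.

Lemma Ck_on_sum W k U (I : Type) (r : seq I) (f : I -> 'rV[R]_m -> W) : open U ->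
  (forall i, Ck_on k U (f i)) -> Ck_on k U (fun x => \sum_(i <- r) f i x).
Proof.
move=> oU Cf; elim: r => [|i r IH].
  by apply: (eq_Ck_on _ _ (Ck_on_cst _ _ 0)) => // x _; rewrite big_nil.
apply: (eq_Ck_on _ _ (Ck_onD oU (Cf i) IH)) => // x _.
by rewrite big_cons.
Qed.

Lemma diff_coord n (f : 'rV[R]_m -> 'rV[R]_n) (i : 'I_n) x :
  differentiable f x ->
  is_diff x (fun y => f y 0 i : R^o) (fun v => 'd f x v 0 i).
Proof.
move=> df; pose c (N : 'rV[R]_n) := N 0 i : R^o.
have cl : linear c by move=> a u v; rewrite /c !mxE.
pose cM := GRing.isLinear.Build _ _ _ _ _ cl.
pose cL : {linear 'rV[R]_n -> R^o} := HB.pack c cM.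
have cc : continuous cL by exact: coord_continuous.
have dc y : differentiable cL y by exact: linear_differentiable.
apply: DiffDef; first exact: (@differentiable_comp _ _ _ _ f cL).
by rewrite -[fun y => _]/(cL \o f) diff_comp// diff_lin.
Qed.

Lemma Ck_on_coord n k U (f : 'rV[R]_m -> 'rV[R]_n) (i : 'I_n) : open U ->
  Ck_on k U f -> Ck_on k U (fun x => f x 0 i : R^o).
Proof.
move=> oU; elim: k f => [|k IH] f.
  move=> cf x Ux; apply: (@continuous_comp _ _ _ f (fun N : 'rV[R]_n => N 0 i)).
    exact: cf.
  exact: coord_continuous.
case=> df Cf; split=> [x Ux|v]; first by have [] := diff_coord i (df x Ux).
apply: (eq_Ck_on oU _ (IH _ (Cf v))) => x Ux.
by have [_ ->] := diff_coord i (df x Ux).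
Qed.
End Ck.

(** In the chain rule [g] is differentiated in the direction ['d f x v], which moves with [x],
    whereas [Ck_on] only speaks of fixed directions. Expanding that direction in the standard basis
    gives a sum of products of C^k functions. *)
Lemma Ck_on_comp (R : realType) (m n : nat) (W : normedModType R) k
    (U : set 'rV[R]_m) (V : set 'rV[R]_n) (f : 'rV[R]_m -> 'rV[R]_n)
    (g : 'rV[R]_n -> W) : open U -> (forall x, U x -> V (f x)) ->
  Ck_on k U f -> Ck_on k V g -> Ck_on k U (g \o f).
Proof.
move=> oU UV; elim: k f g UV => [|k IH] f g UV.
  move=> cf cg x Ux; apply: continuous_comp; first exact: cf.
  exact/cg/UV.
move=> Cf Cg; have [df Cf'] := Cf; have [dg Cg'] := Cg.
split=> [x Ux|v].
  exact: (differentiable_comp (df x Ux) (dg _ (UV x Ux))).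
have H i : Ck_on k U (fun x => ('d f x v 0 i : R^o) *:
    ((fun y => 'd g y (delta_mx 0 i)) \o f) x).
  apply: (Ck_onZ oU); first exact: (Ck_on_coord _ oU (Cf' v)).
  exact: (IH _ _ UV (Ck_onW Cf) (Cg' _)).
apply: (eq_Ck_on oU _ (Ck_on_sum (index_enum 'I_n) oU H)) => x Ux.
rewrite (diff_comp (df x Ux) (dg _ (UV x Ux))).
rewrite /= [in RHS](row_sum_delta ('d f x v)) linear_sum.
by apply: eq_bigr => i _; rewrite linearZ.
Qed.

(** * Symmetry of second derivatives *)

Section Schwarz.
Variables (R : realType) (m : nat).
Implicit Types (f g : 'rV[R]_m -> R^o) (x u v : 'rV[R]_m).

Lemma line_MVT g x v (h : R) : 0 < h ->
  (forall s : R, 0 <= s <= h -> differentiable g (x + s *: v)) ->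
  exists2 c, 0 <= c <= h & g (x + h *: v) - g x = h * 'd g (x + c *: v) v.
Proof.
move=> h0 dg; pose l := (fun s : R => x + s *: v).
have dl s : is_diff s l ( *:%R ^~ v).
  rewrite (_ : ( *:%R ^~ v) = 0 + ( *:%R ^~ v)); last first.
    by apply/funext => t; rewrite fctE add0r.
  exact: (is_diffD (is_diff_cst x s) (is_diff_scalel s v)).
have dgl s : 0 <= s <= h -> is_diff s (g \o l) ('d g (l s) \o ( *:%R ^~ v)).
  move=> sh; have dls := dl s; apply: (is_diff_comp (f := l)).
  exact: (differentiableP (dg s sh)).
have [||c] := @MVT R (g \o l) (fun s => 'd g (l s) v) 0 h h0.
- move=> s; rewrite in_itv /= => /andP[/ltW s0 /ltW sh].
  have [d1 d2] := dgl s (introT andP (conj s0 sh)).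
  apply: DeriveDef; first exact: diff_derivable.
  by rewrite deriveE// d2 /= scale1r.
- apply: continuous_in_subspaceT => s; rewrite inE /= in_itv /= => sh.
  by apply: differentiable_continuous; have [] := dgl s sh.
rewrite in_itv /= => /andP[/ltW c0 /ltW ch]; rewrite /l scale0r addr0 subr0 => E.
by exists c; [rewrite c0|rewrite mulrC].
Qed.

Definition diff2 f x u v : R := 'd (fun y => 'd f y u : R^o) x v.

(** The mean value theorem is applied twice: to y -> f (y + h v) - f y in the direction [u], then to
    the derivative of [f] along [u] in the direction [v]. *)
Lemma second_difference_MVT f x u v (h : R) : 0 < h ->
  (forall a b : R, 0 <= a <= h -> 0 <= b <= h ->
     differentiable f (x + a *: u + b *: v) /\
     differentiable (fun y => 'd f y u : R^o) (x + a *: u + b *: v)) ->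
  exists a b : R, [/\ 0 <= a <= h, 0 <= b <= h &
    f (x + h *: u + h *: v) - f (x + h *: u) - (f (x + h *: v) - f x)
    = h * (h * diff2 f (x + a *: u + b *: v) u v)].
Proof.
move=> h0 df; have h00 : (0 : R) <= 0 <= h by rewrite lexx ltW.
have hh : 0 <= h <= h by rewrite lexx ltW.
pose g y : R^o := f (y + h *: v) - f y.
have dg (s : R) : 0 <= s <= h ->
    is_diff (x + s *: u) g (fun w => 'd f (x + s *: u + h *: v) w - 'd f (x + s *: u) w).
  move=> sh; have [d1 _] := df s h sh hh; have [] := df s 0 sh h00.
  rewrite scale0r addr0 => d0 _.
  pose t := (fun y => y + h *: v).
  have dt : is_diff (x + s *: u) t id.
    rewrite (_ : id = id + 0); last by apply/funext => w; rewrite fctE addr0.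
    exact: (is_diffD (is_diff_id _) (is_diff_cst (h *: v) _)).
  have dft := is_diff_comp dt (differentiableP (d1 : differentiable f (t (x + s *: u)))).
  exact: (is_diffB dft (differentiableP d0)).
have [s sh|a ah E] := @line_MVT g x u h h0; first by have [] := dg s sh.
have [_ dga] := dg a ah.
have [s sh|b bh E'] := @line_MVT (fun y => 'd f y u) (x + a *: u) v h h0.
  by have [] := df a s ah sh.
exists a, b; split=> //; rewrite -E'.
exact: etrans E (congr1 ( *%R h) (congr1 (@^~ u) dga)).
Qed.

(* Both second derivatives are values of the same second difference quotient, at
   points of a small parallelogram at x. *)
Lemma diff2C f (U : set 'rV[R]_m) x u v : open U -> U x -> Ck_on 2 U f ->
  diff2 f x u v = diff2 f x v u.
Proof.
move=> oU Ux [df Cf].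
have d2 w y : U y -> differentiable (fun z => 'd f z w : R^o) y.
  by case: (Cf w) => + _; apply.
have c2 w w' y : U y -> {for y, continuous (fun z => diff2 f z w w' : R^o)}.
  by case: (Cf w) => _ /(_ w'); apply.
apply/eqP; rewrite -subr_eq0; apply/negP => /negP ne.
(* Half of the supposed gap: both second derivatives at [x] will lie within [e] of one common
   value. *)
pose e := `|diff2 f x u v - diff2 f x v u| / 2.
have e0 : 0 < e by rewrite divr_gt0// normr_gt0.
have : \forall y \near x, [/\ U y, `|diff2 f x u v - diff2 f y u v| < e &
    `|diff2 f x v u - diff2 f y v u| < e].
  have n1 : \forall y \near x, U y by exact: open_nbhs_nbhs.
  have /cvgrPdist_lt /(_ _ e0) n2 := c2 u v x Ux.
  have /cvgrPdist_lt /(_ _ e0) n3 := c2 v u x Ux.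
  exact: filterS3 n1 n2 n3.
move=> /nbhs_ballP[d /= d0 H].
(* This makes h (|u| + |v|) < d, so the parallelogram stays in the ball; the [+ 1] covers the case u
   = v = 0. *)
pose h := d / (`|u| + `|v| + 1).
have s0 : 0 < `|u| + `|v| + 1 by rewrite ltr_wpDl// addr_ge0.
have h0 : 0 < h by rewrite divr_gt0.
have {}H a b : 0 <= a <= h -> 0 <= b <= h -> [/\ U (x + a *: u + b *: v),
    `|diff2 f x u v - diff2 f (x + a *: u + b *: v) u v| < e &
    `|diff2 f x v u - diff2 f (x + a *: u + b *: v) v u| < e].
  move=> /andP[a0 ah] /andP[b0 bh]; apply: H.
  rewrite -ball_normE /ball_ /= -addrA opprD addrA subrr add0r normrN.
  apply: (le_lt_trans (ler_normD _ _)); rewrite !normrZ !ger0_norm//.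
  apply: (@le_lt_trans _ _ (h * (`|u| + `|v|))).
    by rewrite mulrDr lerD// ler_wpM2r.
  by rewrite /h -mulrA gtr_pMr// mulrC ltr_pdivrMr// mul1r ltrDl.
have [a b ah bh|a [b [ah bh E1]]] := @second_difference_MVT f x u v h h0.
  by have [Uy _ _] := H a b ah bh; split; [exact: df|exact: d2].
have [b' a' bh' ah'|b' [a' [bh' ah' E2]]] := @second_difference_MVT f x v u h h0.
  have [Uy _ _] := H a' b' ah' bh'; rewrite addrAC.
  by split; [exact: df|exact: d2].
have E : diff2 f (x + a *: u + b *: v) u v = diff2 f (x + b' *: v + a' *: u) v u.
  have hn : h != 0 by rewrite gt_eqF.
  apply: (mulfI hn); apply: (mulfI hn); rewrite -E1 -E2 (addrAC x).
  by rewrite !opprB !addrA [LHS]addrAC [RHS]addrAC; congr (_ + _); exact: addrAC.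
have [_ H1 _] := H a b ah bh; have [_ _ H2] := H a' b' ah' bh'.
rewrite addrAC -E in H2.
suff : `|diff2 f x u v - diff2 f x v u| < e + e by rewrite /e -splitr ltxx.
rewrite -(subrKA (diff2 f (x + a *: u + b *: v) u v)).
apply: (le_lt_trans (ler_normD _ _)); apply: ltrD => //.
by rewrite distrC.
Qed.
End Schwarz.

(** * Germs of smooth maps *)

Section SmoothAt.
Variables (R : realType) (m : nat).
Implicit Types (W : normedModType R) (x : 'rV[R]_m).

Lemma smooth_at_near W (f : 'rV[R]_m -> W) x :
  smooth_at f x -> \forall y \near x, smooth_at f y.
Proof.
case=> U [oU Ux Sf]; apply: filterS (open_nbhs_nbhs (conj oU Ux)) => y Uy.
by exists U.
Qed.

Lemma smooth_at_differentiable W (f : 'rV[R]_m -> W) x :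
  smooth_at f x -> differentiable f x.
Proof. by case=> U [oU Ux /(_ 1%N)[df _]]; exact: df. Qed.

Lemma near_eq_smooth_at W (f g : 'rV[R]_m -> W) x :
  (\near x, f x = g x) -> smooth_at f x -> smooth_at g x.
Proof.
move=> /nbhs_interior; rewrite nbhsE => -[V [oV Vx] sV] [U [oU Ux Sf]].
exists (U `&` V); split=> // [|k]; first exact: openI.
apply: (eq_Ck_on (openI oU oV) _ (subset_Ck_on _ (Sf k))) => [y [_ /sV]|y []//].
exact: nbhs_singleton.
Qed.

Lemma smooth_at_cst W (c : W) x : smooth_at (fun=> c) x.
Proof.
exists setT; split=> //; first exact: openT.
by move=> k; exact: Ck_on_cst.
Qed.

Lemma smooth_atD W (f g : 'rV[R]_m -> W) x :
  smooth_at f x -> smooth_at g x -> smooth_at (fun y => f y + g y) x.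
Proof.
move=> [U [oU Ux Sf]] [V [oV Vx Sg]]; have oUV := openI oU oV.
exists (U `&` V); split=> // k; apply: (Ck_onD oUV).
  by apply: subset_Ck_on (Sf k) => y [].
by apply: subset_Ck_on (Sg k) => y [].
Qed.

Lemma smooth_atZ W (h : 'rV[R]_m -> R^o) (f : 'rV[R]_m -> W) x :
  smooth_at h x -> smooth_at f x -> smooth_at (fun y => h y *: f y) x.
Proof.
move=> [U [oU Ux Sf]] [V [oV Vx Sg]]; have oUV := openI oU oV.
exists (U `&` V); split=> // k; apply: (Ck_onZ oUV).
  by apply: subset_Ck_on (Sf k) => y [].
by apply: subset_Ck_on (Sg k) => y [].
Qed.

Lemma smooth_at_coord n (f : 'rV[R]_m -> 'rV[R]_n) (i : 'I_n) x :
  smooth_at f x -> smooth_at (fun y => f y 0 i : R^o) x.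
Proof.
by case=> U [oU Ux Sf]; exists U; split=> // k; exact: Ck_on_coord.
Qed.

Lemma smooth_at_diff W (f : 'rV[R]_m -> W) v x :
  smooth_at f x -> smooth_at (fun y => 'd f y v) x.
Proof.
by case=> U [oU Ux Sf]; exists U; split=> // k; have [_ +] := Sf k.+1; apply.
Qed.

(** Coordinatewise reduction to [diff2C]: near [x] the [i]-th coordinate of the differential is the
    differential of the [i]-th coordinate. *)
Lemma smooth_at_diffC n (F : 'rV[R]_m -> 'rV[R]_n) (i : 'I_n) x u v :
  smooth_at F x ->
  'd (fun y => 'd F y u 0 i : R^o) x v = 'd (fun y => 'd F y v 0 i : R^o) x u.
Proof.
move=> SF; pose f y : R^o := F y 0 i.
have E w : \forall y \near x, 'd f y w = 'd F y w 0 i.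
  apply: filterS (smooth_at_near SF) => y /smooth_at_differentiable dF.
  by have [_ ->] := diff_coord i dF.
have [U [oU Ux Sf]] := smooth_at_coord i SF.
have df w : differentiable (fun y => 'd f y w : R^o) x.
  by case: (Sf 2%N) => _ /(_ w)[+ _]; apply.
have [_ Eu] := near_eq_diff (E u) (df u); have [_ Ev] := near_eq_diff (E v) (df v).
apply: etrans (congr1 (@^~ v) Eu) (etrans _ (esym (congr1 (@^~ u) Ev))).
exact: (diff2C u v oU Ux (Sf 2%N)).
Qed.
End SmoothAt.

Lemma smooth_at_comp (R : realType) (m n : nat) (W : normedModType R)
    (f : 'rV[R]_m -> 'rV[R]_n) (g : 'rV[R]_n -> W) x :
  smooth_at f x -> smooth_at g (f x) -> smooth_at (g \o f) x.
Proof.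
move=> Sf [V [oV Vx Sg]].
have cf : {for x, continuous f}.
  exact/differentiable_continuous/smooth_at_differentiable.
have [U [oU Ux Sf']] := Sf.
have /nbhs_interior : \forall y \near x, V (f y).
  by apply: cf; exact: open_nbhs_nbhs.
rewrite nbhsE => -[T [oT Tx] sT].
exists (U `&` T); split=> // [|k]; first exact: openI.
apply: (Ck_on_comp (V := V) (openI oU oT)) => // [y [_ /sT]|].
  exact: nbhs_singleton.
by apply: subset_Ck_on (Sf' k) => y [].
Qed.

(** * Changes of charts and coordinate frames *)

Section Charts.
Variables (R : realType) (m : nat) (M : manifold R m).
Implicit Types (p q r : M) (u v : 'rV[R]_m).

Lemma near_chartV p q (P : M -> Prop) : dom p q ->
  (\forall q' \near q, P q') -> \forall x \near chart p q, P (chartV p x).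
Proof.
move=> pq; have := chartV_continuous (imageP (chart p) pq).
by rewrite /prop_for /continuous_at chartK//; apply.
Qed.

Lemma near_dom p q : dom p q -> \forall q' \near q, dom p q'.
Proof. by move=> pq; apply: open_nbhs_nbhs; split; [exact: dom_open|]. Qed.

Lemma near_chart_image p q : dom p q ->
  \forall x \near chart p q, dom p (chartV p x) /\ chart p (chartV p x) = x.
Proof.
move=> pq; have : \forall x \near chart p q, (chart p @` dom p) x.
  by apply: open_nbhs_nbhs; split; [exact: chart_open|exact: imageP].
by apply: filterS => _ [q' pq' <-]; rewrite !chartK.
Qed.

Lemma smooth_at_transition p q r : dom p r -> dom q r ->
  smooth_at (chart q \o chartV p) (chart p r).
Proof.
(* [chart_compat] gives smoothness on the image of the overlap without stating that this image is
   open, hence the passage to its interior. *)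
move=> pr qr; exists (interior (chart p @` (dom p `&` dom q))).
split=> [||k]; first exact: open_interior.
  rewrite /interior /=.
  apply: filterS2 (near_chart_image pr) (near_chartV pr (near_dom qr)).
  by move=> x [px E] qx; exists (chartV p x).
exact: (subset_Ck_on (@interior_subset _ _) (@chart_compat R m M p q k)).
Qed.

Lemma differentiable_transition p q r : dom p r -> dom q r ->
  differentiable (chart q \o chartV p) (chart p r).
Proof. by move=> pr qr; exact/smooth_at_differentiable/smooth_at_transition. Qed.

(** Cocycle rule for the differentials of transition maps: near [chart p r] the composite of two
    transitions is the third one. *)
Lemma diff_transition_trans p q s r v : dom p r -> dom q r -> dom s r ->
  'd (chart s \o chartV q) (chart q r) ('d (chart q \o chartV p) (chart p r) v)
  = 'd (chart s \o chartV p) (chart p r) v.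
Proof.
move=> pr qr sr; pose g := (chart s \o chartV q) \o (chart q \o chartV p).
have d1 := differentiable_transition pr qr.
have Eqr : (chart q \o chartV p) (chart p r) = chart q r by rewrite /= chartK.
have d2 : differentiable (chart s \o chartV q) ((chart q \o chartV p) (chart p r)).
  by rewrite Eqr; exact: differentiable_transition.
have E : \forall x \near chart p r, g x = (chart s \o chartV p) x.
  apply: filterS (near_chartV pr (near_dom qr)) => x qx.
  by rewrite /g /= chartK.
apply: esym; apply: etrans (near_eq_diffE v E (differentiable_comp d1 d2)) _.
by apply: etrans (diff_compE v d1 d2) _; rewrite Eqr.
Qed.

Lemma diff_transition_id p r v : dom p r ->
  'd (chart p \o chartV p) (chart p r) v = v.
Proof.
move=> pr; have E : \forall x \near chart p r, id x = (chart p \o chartV p) x.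
  by apply: filterS (near_chart_image pr) => x [].
have [d1 d2] := is_diff_id (chart p r).
exact: etrans (near_eq_diffE v E d1) (congr1 (@^~ v) d2).
Qed.

Lemma to_chart_coord_field p q v : dom p q -> to_chart p q (coord_field p v q) = v.
Proof.
move=> pq; rewrite /to_chart /coord_field diff_transition_trans ?diff_transition_id//.
exact: dom_base.
Qed.

Lemma coord_field_to_chart p q v : dom p q -> coord_field p (to_chart p q v) q = v.
Proof.
move=> pq; rewrite /to_chart /coord_field diff_transition_trans ?diff_transition_id//;
exact: dom_base.
Qed.

Lemma to_chart_id p v : to_chart p p v = v.
Proof. by apply: diff_transition_id; exact: dom_base. Qed.

Lemma coord_field_id p v : coord_field p v p = v.
Proof. by apply: diff_transition_id; exact: dom_base. Qed.

(* Made total by an arbitrary isomorphism off [dom p], so that every vector field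
   is globally a combination of the [frame p e_i] and no cut-off is needed. *)
Definition frame p v q := if `[< dom p q >] then coord_field p v q else v.
Definition coframe p q v := if `[< dom p q >] then to_chart p q v else v.

Lemma frame_coframe p q v : frame p (coframe p q v) q = v.
Proof.
by rewrite /frame /coframe; case: asboolP => // pq; exact: coord_field_to_chart.
Qed.

Lemma frame_id p v : frame p v p = v.
Proof. by rewrite /frame; case: asboolP => // _; exact: coord_field_id. Qed.

Lemma coframe_id p v : coframe p p v = v.
Proof. by rewrite /coframe; case: asboolP => // _; exact: to_chart_id. Qed.

Lemma frame_is_linear p q : linear (frame p ^~ q).
Proof.
by move=> a u v; rewrite /frame /coord_field; case: asboolP => // _; rewrite linearP.
Qed.

Lemma coframe_is_linear p q : linear (coframe p q).
Proof.
by move=> a u v; rewrite /coframe /to_chart; case: asboolP => // _; rewrite linearP.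
Qed.

Lemma near_frame p v : \forall q \near p, coord_field p v q = frame p v q.
Proof. by apply: filterS (near_dom (dom_base p)) => q /asboolT; rewrite /frame => ->. Qed.

Lemma near_eq_fun_smooth_at (W : normedModType R) (f g : M -> W) p :
  (\forall q \near p, f q = g q) -> fun_smooth_at f p -> fun_smooth_at g p.
Proof. by move=> /(near_chartV (dom_base p)); exact: near_eq_smooth_at. Qed.

Lemma near_eq_dfun (W : normedModType R) (f g : M -> W) p v :
  (\forall q \near p, f q = g q) -> fun_smooth_at f p -> dfun g p v = dfun f p v.
Proof.
move=> /(near_chartV (dom_base p)) E /smooth_at_differentiable df.
exact: near_eq_diffE E df.
Qed.

Lemma dfun_cst (W : normedModType R) (c : W) p v : dfun (fun=> c) p v = 0.
Proof. by rewrite /dfun /= [X in diff _ X _](_ : _ = cst c)// diff_cst. Qed.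

End Charts.

(** * Sections of pull-back bundles *)

Section Sections.
Variables (R : realType) (k m : nat) (B : manifold R k) (M : manifold R m).
Variable f : B -> M.
Implicit Types (E : M -> set 'rV[R]_m) (s t : B -> 'rV[R]_m).

Lemma near_eq_section_at E s t b :
  (\forall b' \near b, s b' = t b') -> section_at f E s b -> section_at f E t b.
Proof.
move=> st [Ss Es]; split.
  apply: near_eq_smooth_at Ss.
  by apply: filterS (near_chartV (dom_base b) st) => x; rewrite /local_rep => ->.
by apply: filterS2 st Es => b' ->.
Qed.

Lemma section_atD E s t b : (forall q u v, E q u -> E q v -> E q (u + v)) ->
  section_at f E s b -> section_at f E t b ->
  section_at f E (fun b' => s b' + t b') b.
Proof.
move=> ED [Ss Es] [St Et]; split; last by apply: filterS2 Es Et => b'; exact: ED.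
rewrite /local_rep (_ : (fun _ => _) = fun x => local_rep f s b x + local_rep f t b x).
  exact: smooth_atD.
by apply/funext => x; rewrite /local_rep /to_chart linearD.
Qed.

Lemma section_atZ E (h : B -> R^o) s b : (forall q a u, E q u -> E q (a *: u)) ->
  fun_smooth_at h b -> section_at f E s b ->
  section_at f E (fun b' => h b' *: s b') b.
Proof.
move=> EZ Sh [Ss Es]; split; last by apply: filterS Es => b'; exact: EZ.
rewrite /local_rep (_ : (fun _ => _) = fun x => h (chartV b x) *: local_rep f s b x).
  exact: smooth_atZ.
by apply/funext => x; rewrite /local_rep /to_chart linearZ.
Qed.

Lemma section_at_pullback E (Y : M -> 'rV[R]_m) b : smooth_map f ->
  section_at id E Y (f b) -> section_at f E (Y \o f) b.
Proof.
move=> [cf Sf] [SY EY]; split; last exact: cf EY.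
have Sfb := Sf b; pose F := chart (f b) \o f \o chartV b.
have Fb : F (chart b b) = chart (f b) (f b) by rewrite /F /= chartK//; exact: dom_base.
apply: near_eq_smooth_at (smooth_at_comp Sfb (g := local_rep id Y (f b)) _).
  have := near_chartV (dom_base b) (cf b _ (near_dom (dom_base (f b)))).
  by apply: filterS => x fx; rewrite /local_rep /= chartK.
by rewrite -/F Fb.
Qed.

(** [dmap f b'] is expressed in the preferred charts of [b'] and [f b'], which vary with [b'].
    Carried over to the charts at [b] and [f b] it becomes the derivative of a single map, which can
    be differentiated again. *)
Lemma to_chart_dmap b b' v : smooth_map f -> dom b b' -> dom (f b) (f b') ->
  to_chart (f b) (f b') (dmap f b' (coord_field b v b'))
  = 'd (chart (f b) \o f \o chartV b) (chart b b') v.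
Proof.
move=> [cf Sf] bb' fbb'.
pose F' := chart (f b') \o f \o chartV b'.
pose T := chart b' \o chartV b.
have F'b : F' (chart b' b') = chart (f b') (f b').
  by rewrite /F' /= chartK//; exact: dom_base.
have dF' : differentiable F' (T (chart b b')).
  by rewrite /T /= chartK//; exact: smooth_at_differentiable (Sf b').
have dT : differentiable T (chart b b') := differentiable_transition bb' (dom_base b').
have Tb : T (chart b b') = chart b' b' by rewrite /T /= chartK.
have FTb : (F' \o T) (chart b b') = chart (f b') (f b') by rewrite /= Tb F'b.
have dG : differentiable (chart (f b) \o chartV (f b')) ((F' \o T) (chart b b')).
  by rewrite FTb; exact: differentiable_transition (dom_base _) fbb'.
have dFT := differentiable_comp dT dF'.
have E : \forall x \near chart b b', ((chart (f b) \o chartV (f b')) \o (F' \o T)) x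
    = (chart (f b) \o f \o chartV b) x.
  have n1 := near_chartV bb' (near_dom (dom_base b')).
  have n2 := near_chartV bb' (cf b' _ (near_dom (dom_base (f b')))).
  by apply: filterS2 n1 n2 => x d1 d2; rewrite /T /F' /= chartK// chartK.
apply: esym; apply: etrans (near_eq_diffE v E (differentiable_comp dFT dG)) _.
apply: etrans (diff_compE v dFT dG) _; rewrite FTb; congr ('d _ _ _).
by apply: etrans (diff_compE v dT dF') _; rewrite Tb.
Qed.
End Sections.

(** * Smooth vector fields and their components *)

Section VectorFields.
Variables (R : realType) (m : nat) (M : manifold R m).
Implicit Types (p q : M) (u v : 'rV[R]_m) (Y Z : M -> 'rV[R]_m).

Lemma vfield_atD Y Z p : vfield_at Y p -> vfield_at Z p ->
  vfield_at (fun q => Y q + Z q) p.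
Proof. exact: section_atD. Qed.

Lemma vfield_atZ (h : M -> R^o) Y p : fun_smooth_at h p -> vfield_at Y p ->
  vfield_at (fun q => h q *: Y q) p.
Proof. exact: section_atZ. Qed.

Lemma vfield_at_coord_field p v : vfield_at (coord_field p v) p.
Proof.
split; last exact: nearW.
apply: (near_eq_smooth_at _ (smooth_at_cst v _)).
apply: filterS (near_chartV (dom_base p) (near_dom (dom_base p))) => x px.
by rewrite /local_rep /= to_chart_coord_field.
Qed.

Lemma vfield_at_frame p v : vfield_at (frame p v) p.
Proof. exact: near_eq_section_at (near_frame p v) (vfield_at_coord_field p v). Qed.

Lemma vfield_component Y p i : vfield_at Y p ->
  let h q := coframe p q (Y q) 0 i : R^o in
  fun_smooth_at h p /\
  forall u, dfun h p u = 'd (local_rep id Y p) (chart p p) u 0 i.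
Proof.
move=> [SY _] h.
have E : \forall x \near chart p p, local_rep id Y p x 0 i = (h \o chartV p) x.
  apply: filterS (near_chartV (dom_base p) (near_dom (dom_base p))) => x px.
  by rewrite /h /coframe /local_rep /= asboolT.
split; first exact: near_eq_smooth_at E (smooth_at_coord i SY).
move=> u; have [d1 d2] := diff_coord i (smooth_at_differentiable SY).
exact: etrans (near_eq_diffE u E d1) (congr1 (@^~ u) d2).
Qed.
End VectorFields.

(** * Christoffel symbols and torsion of an affine connection *)

Section AffineConnection.
Variables (R : realType) (m : nat) (M : manifold R m).
Variable nabla : (M -> 'rV[R]_m) -> M -> 'rV[R]_m -> 'rV[R]_m.
Hypothesis affine_nabla : affine_connection nabla.
Implicit Types (p q : M) (u v z : 'rV[R]_m) (Y Z : M -> 'rV[R]_m).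

Lemma nabla_linear Y p : vfield_at Y p -> linear (nabla Y p).
Proof. by case: affine_nabla => + _ _ _; apply. Qed.

Lemma nablaD Y Z p u : vfield_at Y p -> vfield_at Z p ->
  nabla (fun q => Y q + Z q) p u = nabla Y p u + nabla Z p u.
Proof. by case: affine_nabla => _ + _ _ SY SZ; apply. Qed.

Lemma nabla_leibniz (h : M -> R^o) Y p u : fun_smooth_at h p -> vfield_at Y p ->
  nabla (fun q => h q *: Y q) p u = dfun h p u *: Y p + h p *: nabla Y p u.
Proof. by case: affine_nabla => _ _ + _ Sh SY; apply. Qed.

Lemma fun_smooth_at_cst (c : R^o) p : fun_smooth_at (fun _ : M => c) p.
Proof. exact: smooth_at_cst. Qed.

Lemma nablaZ (c : R) Y p u : vfield_at Y p ->
  nabla (fun q => c *: Y q) p u = c *: nabla Y p u.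
Proof.
move=> SY; rewrite (nabla_leibniz (h := fun=> c))//; last exact: fun_smooth_at_cst.
by rewrite dfun_cst scale0r add0r.
Qed.

Lemma vfield_at_cst0 p : vfield_at (fun=> 0) p.
Proof.
rewrite (_ : (fun=> 0) = coord_field p 0); first exact: vfield_at_coord_field.
by apply/funext => q; rewrite /coord_field linear0.
Qed.

Lemma vfield_at_sum (I : Type) (r : seq I) (Y : I -> M -> 'rV[R]_m) p :
  (forall i, vfield_at (Y i) p) -> vfield_at (fun q => \sum_(i <- r) Y i q) p.
Proof.
move=> SY; elim: r => [|i r IH].
  rewrite (_ : (fun _ => _) = fun=> 0); first exact: vfield_at_cst0.
  by apply/funext => q; rewrite big_nil.
rewrite (_ : (fun _ => _) = fun q => Y i q + \sum_(j <- r) Y j q).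
  exact: vfield_atD.
by apply/funext => q; rewrite big_cons.
Qed.

Lemma nabla_sum (I : Type) (r : seq I) (Y : I -> M -> 'rV[R]_m) p u :
  (forall i, vfield_at (Y i) p) ->
  nabla (fun q => \sum_(i <- r) Y i q) p u = \sum_(i <- r) nabla (Y i) p u.
Proof.
move=> SY; elim: r => [|i r IH].
  rewrite big_nil (_ : (fun _ => _) = fun q => 0 *: (fun _ : M => 0) q).
    by rewrite nablaZ ?scale0r//; exact: vfield_at_cst0.
  by apply/funext => q; rewrite big_nil scale0r.
rewrite big_cons (_ : (fun _ => _) = fun q => Y i q + \sum_(j <- r) Y j q).
  by rewrite nablaD ?IH//; exact: vfield_at_sum.
by apply/funext => q; rewrite big_cons.
Qed.

(** The [G] of the overview, taken only at the base point of the chart, where [frame p z] has the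
    value [z]. *)
Definition christoffel p u z := nabla (frame p z) p u.

Lemma christoffel_linearl p z : linear (christoffel p ^~ z).
Proof. by move=> a u v; apply: nabla_linear; exact: vfield_at_frame. Qed.

Lemma christoffel_linearr p u : linear (christoffel p u).
Proof.
move=> a z z'; rewrite /christoffel.
rewrite (_ : frame p _ = fun q => (fun q' => a *: frame p z q') q + frame p z' q).
  rewrite nablaD ?nablaZ//; try exact: vfield_at_frame.
  by apply: (vfield_atZ (h := fun=> a)); [exact: fun_smooth_at_cst|exact: vfield_at_frame].
by apply/funext => q; rewrite frame_is_linear.
Qed.

(** [frame_coframe] holds at every point, so [Z] equals its frame expansion as a function on [M],
    and additivity and Leibniz apply to that sum directly. *)
Lemma nabla_christoffel Z p u : vfield_at Z p ->
  nabla Z p u = 'd (local_rep id Z p) (chart p p) u + christoffel p u (Z p).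
Proof.
move=> SZ; pose h i q : R^o := coframe p q (Z q) 0 i.
have Sh i : fun_smooth_at (h i) p by have [] := vfield_component i SZ.
have SF i : vfield_at (frame p (delta_mx 0 i)) p by exact: vfield_at_frame.
have -> : nabla Z p u = nabla (fun q =>
    \sum_i h i q *: frame p (delta_mx 0 i) q) p u.
  congr (nabla _ p u); apply/funext => q.
  rewrite -[LHS](frame_coframe p q) [in LHS](row_sum_delta (coframe p q (Z q))).
  pose L := GRing.isLinear.Build _ _ _ _ _ (frame_is_linear p q).
  pose fL : {linear 'rV[R]_m -> 'rV[R]_m} := HB.pack (frame p ^~ q) L.
  rewrite -[LHS]/(fL _) linear_sum; apply: eq_bigr => i _.
  by rewrite linearZ.
rewrite (@nabla_sum _ _ (fun i q => h i q *: frame p (delta_mx 0 i) q) p u); last first.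
  by move=> i; exact: vfield_atZ.
pose L := GRing.isLinear.Build _ _ _ _ _ (christoffel_linearr p u).
pose cL : {linear 'rV[R]_m -> 'rV[R]_m} := HB.pack (christoffel p u) L.
rewrite -[christoffel p u (Z p)]/(cL _) [in RHS](row_sum_delta (Z p)) linear_sum.
rewrite [X in _ = X + _]row_sum_delta -big_split; apply: eq_bigr => i _.
rewrite linearZ /= nabla_leibniz// frame_id /h coframe_id.
by have [_ ->] := vfield_component i SZ.
Qed.

(** The two derivative terms are exactly the bracket; what remains depends only on the values of [Y]
    and [Z] at [p]. *)
Lemma torsion_christoffel Y Z p : vfield_at Y p -> vfield_at Z p ->
  torsion nabla Y Z p = christoffel p (Y p) (Z p) - christoffel p (Z p) (Y p).
Proof.
move=> SY SZ; rewrite /torsion !nabla_christoffel// /bracket.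
have E (a b c d : 'rV[R]_m) : a + c - (b + d) - (a - b) = c - d.
  by rewrite [- (b + d)]opprD addrACA [LHS]addrC addrA addNr add0r.
exact: E.
Qed.
End AffineConnection.

(** * Linearity rules for unbundled maps *)

Section LinearMaps.
Variables (R : realType) (V W : lmodType R) (f : V -> W).
Hypothesis fL : linear f.

Let f' : {linear V -> W} := HB.pack f (GRing.isLinear.Build _ _ _ _ _ fL).

Lemma lin0 : f 0 = 0. Proof. exact: (linear0 f'). Qed.
Lemma linD u v : f (u + v) = f u + f v. Proof. exact: (linearD f'). Qed.
Lemma linN u : f (- u) = - f u. Proof. exact: (linearN f'). Qed.
Lemma linB u v : f (u - v) = f u - f v. Proof. exact: (linearB f'). Qed.
Lemma linZ a u : f (a *: u) = a *: f u. Proof. exact: (linearZZ f'). Qed.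
Lemma linsum (I : Type) (r : seq I) (u : I -> V) :
  f (\sum_(i <- r) u i) = \sum_(i <- r) f (u i).
Proof. exact: (linear_sum f'). Qed.
End LinearMaps.

Lemma lin_rowE (R : realType) (m : nat) (W : lmodType R) (f : 'rV[R]_m -> W) u :
  linear f -> f u = \sum_i u 0 i *: f (delta_mx 0 i).
Proof.
move=> fL; rewrite [in LHS](row_sum_delta u) (linsum fL).
by apply: eq_bigr => i _; rewrite (linZ fL).
Qed.

(** * Reeb field, J and torsion for the contact triad connection *)

Section ContactTriad.
Variables (R : realType) (n : nat).
Local Notation m := n.*2.+1.
Variables (M : manifold R m) (lam : M -> 'rV[R]_m -> R^o) (X : M -> 'rV[R]_m).
Variables (J : M -> 'rV[R]_m -> 'rV[R]_m).
Variable nabla : (M -> 'rV[R]_m) -> M -> 'rV[R]_m -> 'rV[R]_m.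
Hypothesis triadM : contact_triad lam X J.
Hypothesis triad_nabla : contact_triad_connection lam X J nabla.
Implicit Types (p q : M) (u v : 'rV[R]_m) (Y Z : M -> 'rV[R]_m).
Local Notation pi := (proj_xi lam X).
Local Notation xi := (contact_str lam).

Let affine_nabla := ctc_affine triad_nabla.

Lemma lam_linear p : linear (lam p).
Proof. by case: triadM => -[+ _ _] _ _; apply. Qed.

Lemma lam_reeb p : lam p (X p) = 1.
Proof. by case: triadM => _ [_ + _] _; apply. Qed.

Lemma vfield_at_reeb p : vfield_at X p.
Proof. by case: triadM => _ [+ _ _] _; apply. Qed.

Lemma proj_xi_linear p : linear (pi p).
Proof.
move=> a u v; rewrite /proj_xi lam_linear scalerDl scalerBr opprD addrACA.
by rewrite -scalerA.
Qed.

Lemma proj_xi_reeb p : pi p (X p) = 0.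
Proof. by rewrite /proj_xi lam_reeb scale1r subrr. Qed.

Lemma lam_proj_xi p v : lam p (pi p v) = 0.
Proof.
rewrite /proj_xi (linB (lam_linear p)) (linZ (lam_linear p)) lam_reeb.
by rewrite [_ *: _]mulr1 subrr.
Qed.

Lemma proj_xi_id p v : lam p v = 0 -> pi p v = v.
Proof. by move=> lv; rewrite /proj_xi lv scale0r subr0. Qed.

Lemma proj_xi_decomp p v : v = pi p v + lam p v *: X p.
Proof. by rewrite /proj_xi subrK. Qed.

Lemma J_linear p : linear (J p).
Proof. by case: triadM => _ _ [[+ _] _ _ _ _]; apply. Qed.

Lemma J_proj_xi p v : J p (pi p v) = J p v.
Proof.
rewrite /proj_xi (linB (J_linear p)) (linZ (J_linear p)).
by case: triadM => _ _ [_ -> _ _ _]; rewrite scaler0 subr0.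
Qed.

Lemma lam_J p v : lam p (J p v) = 0.
Proof.
rewrite -J_proj_xi; case: triadM => _ _ [_ _ + _ _].
by move=> /(_ p (pi p v) (lam_proj_xi p v))[].
Qed.

Lemma JJ p v : lam p v = 0 -> J p (J p v) = - v.
Proof. by move=> lv; case: triadM => _ _ [_ _ + _ _] => /(_ p v lv)[]. Qed.

Lemma fun_smooth_at_lam_coord_field p v :
  fun_smooth_at (fun q => lam q (coord_field p v q) : R^o) p.
Proof. by case: triadM => -[_ + _] _ _; apply. Qed.

Lemma vfield_at_J_coord_field p v : vfield_at (fun q => J q (coord_field p v q)) p.
Proof. by case: triadM => _ _ [[_ +] _ _ _ _]; apply. Qed.

Lemma vfield_at_proj_xi Y p : vfield_at Y p ->
  fun_smooth_at (fun q => lam q (Y q) : R^o) p ->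
  vfield_at (fun q => pi q (Y q)) p.
Proof.
move=> SY Sl; rewrite /proj_xi.
rewrite (_ : (fun _ => _) =
    fun q => Y q + (((-1 : R^o) *: (lam q (Y q) : R^o)) : R^o) *: X q).
  apply: vfield_atD => //.
  apply: (vfield_atZ (h := fun q => (-1 : R^o) *: (lam q (Y q) : R^o))).
    exact: (smooth_atZ (smooth_at_cst _ _) Sl).
  exact: vfield_at_reeb.
by apply/funext => q; rewrite [_ *: lam _ _]mulN1r scaleNr.
Qed.

Lemma section_at_proj_xi Y p : vfield_at Y p ->
  fun_smooth_at (fun q => lam q (Y q) : R^o) p ->
  section_at id xi (fun q => pi q (Y q)) p.
Proof.
move=> SY Sl; have [S _] := vfield_at_proj_xi SY Sl; split=> //.
by apply: nearW => q; exact: lam_proj_xi.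
Qed.

Lemma nabla_proj_xi Y p u : vfield_at Y p ->
  fun_smooth_at (fun q => lam q (Y q) : R^o) p ->
  nabla Y p u = nabla (fun q => pi q (Y q)) p u +
    (dfun (fun q => lam q (Y q) : R^o) p u *: X p + lam p (Y p) *: nabla X p u).
Proof.
move=> SY Sl; have SX := vfield_at_reeb p.
rewrite -(nabla_leibniz affine_nabla u Sl SX) -(nablaD affine_nabla); last first.
- exact: vfield_atZ.
- exact: vfield_at_proj_xi.
by congr (nabla _ p u); apply/funext => q; exact: proj_xi_decomp.
Qed.

Lemma nabla_reeb_linear p : linear (nabla X p).
Proof. exact/(nabla_linear affine_nabla)/vfield_at_reeb. Qed.

Lemma nabla_reeb_proj_xi p u : nabla X p (pi p u) = nabla X p u.
Proof.
have L := nabla_reeb_linear p.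
rewrite [in RHS](proj_xi_decomp p u) [in RHS](linD L) (linZ L).
by rewrite (ctc_reeb_reeb triad_nabla) scaler0 addr0.
Qed.

Lemma lam_nabla_reeb p u : lam p (nabla X p u) = 0.
Proof.
by rewrite -nabla_reeb_proj_xi; apply: (ctc_reeb_xi triad_nabla); exact: lam_proj_xi.
Qed.

(** This is axiom (6) with J applied to it; J squared is minus the identity there because the
    derivatives of X lie in xi. *)
Lemma nabla_reeb_J p u : J p (nabla X p u) = - nabla X p (J p u).
Proof.
have /eqP := ctc_reeb_J triad_nabla (lam_proj_xi p u : xi p (pi p u)).
rewrite subr_eq0 nabla_reeb_proj_xi J_proj_xi => /eqP ->.
by rewrite JJ// lam_nabla_reeb.
Qed.

Lemma extd0r p u : extd lam p u 0 = 0.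
Proof.
rewrite /extd [dfun _ p 0]linear0 subr0.
rewrite (_ : (fun q => _) = fun=> 0 : R^o) ?dfun_cst//.
by apply/funext => q; rewrite /coord_field linear0 (lin0 (lam_linear q)).
Qed.

Lemma triad_metric_reeb p u : triad_metric lam X J p u (X p) = lam p u.
Proof.
rewrite /triad_metric /metric_xi proj_xi_reeb (lin0 (J_linear p)) extd0r.
by rewrite lam_reeb mulr1 add0r.
Qed.

Lemma triad_metric0r p u : triad_metric lam X J p u 0 = 0.
Proof.
rewrite /triad_metric /metric_xi (lin0 (proj_xi_linear p)) (lin0 (J_linear p)).
by rewrite extd0r (lin0 (lam_linear p)) mulr0 addr0.
Qed.

(** Differentiate g(Y, X) = 0 along X. Since nabla_X X = 0, only g(nabla_X Y, X) survives, and
    pairing with X is [lam]. *)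
Lemma lam_nabla_xi Y p : vfield_at Y p -> (forall q, lam q (Y q) = 0) ->
  lam p (nabla Y p (X p)) = 0.
Proof.
move=> SY lY.
have := ctc_metric triad_nabla (X p) SY (vfield_at_reeb p).
rewrite (_ : (fun q => _) = fun=> 0 : R^o); last first.
  by apply/funext => q; rewrite triad_metric_reeb lY.
rewrite dfun_cst (ctc_reeb_reeb triad_nabla).
by rewrite triad_metric0r addr0 triad_metric_reeb => <-.
Qed.

Lemma nabla_reeb_J_coord_field p u :
  nabla (fun q => J q (coord_field p u q)) p (X p)
  = J p (nabla (coord_field p u) p (X p)).
Proof.
set JY := (fun q => _).
have SY := vfield_at_coord_field p u; have Sl := fun_smooth_at_lam_coord_field p u.
have SJY : vfield_at JY p by exact: vfield_at_J_coord_field.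
have [_ _ JH] := ctc_hermitian triad_nabla.
have := JH _ p (X p) (section_at_proj_xi SY Sl).
rewrite (_ : (fun q => J q _) = JY); last first.
  by apply/funext => q; rewrite J_proj_xi.
rewrite /nabla_pi proj_xi_id => [->|]; last first.
  by apply: lam_nabla_xi => // q; exact: lam_J.
rewrite J_proj_xi [in RHS](nabla_proj_xi (X p) SY Sl).
rewrite (ctc_reeb_reeb triad_nabla) scaler0 addr0.
have L := J_linear p; rewrite (linD L) (linZ L).
by case: triadM => _ _ [_ -> _ _ _]; rewrite scaler0 addr0.
Qed.

(** T(X, -) = 0 gives [X, Y] = nabla_X Y - nabla_Y X. The nabla_X terms cancel, leaving J nabla_u X
    - nabla_{Ju} X; these two terms are equal by [nabla_reeb_J], which is where the factor 1/2 comes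
    from. *)
Lemma half_lie_endo_J p u : 2^-1 *: lie_endo X J p u = J p (nabla X p u).
Proof.
have L := J_linear p; rewrite /lie_endo.
have bracketE Y : vfield_at Y p ->
    bracket X Y p = nabla Y p (X p) - nabla X p (Y p).
  move=> SY; have /eqP := ctc_torsion_reeb triad_nabla SY.
  by rewrite /torsion subr_eq0 => /eqP <-.
rewrite !bracketE; [|exact: vfield_at_coord_field|exact: vfield_at_J_coord_field].
rewrite nabla_reeb_J_coord_field coord_field_id (linB L) opprB addrC subrKA.
by rewrite -nabla_reeb_J scalerDr -scalerDl -[2^-1]div1r -splitr scale1r.
Qed.

(** The torsion on tangent vectors at [p] rather than on fields, so that it can be evaluated on dw
    v1 and dw v2. *)
Definition torsion_tensor p u v :=
  christoffel nabla p u v - christoffel nabla p v u.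

Lemma torsion_tensor_linearr p u : linear (torsion_tensor p u).
Proof.
move=> a v v'; rewrite /torsion_tensor (christoffel_linearr affine_nabla).
by rewrite (christoffel_linearl affine_nabla) scalerBr opprD addrACA.
Qed.

Lemma torsion_tensorC p u v : torsion_tensor p u v = - torsion_tensor p v u.
Proof. by rewrite /torsion_tensor opprB. Qed.

Lemma torsion_tensor_linearl p v : linear (torsion_tensor p ^~ v).
Proof.
move=> a u u'.
by rewrite torsion_tensorC torsion_tensor_linearr opprD -scalerN -!(torsion_tensorC p _ v).
Qed.

Lemma torsion_tensor_reebl p v : torsion_tensor p (X p) v = 0.
Proof.
have SF := vfield_at_frame p v.
have := ctc_torsion_reeb triad_nabla SF.
rewrite (torsion_christoffel affine_nabla (vfield_at_reeb p) SF) frame_id //.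
Qed.

Lemma torsion_tensor_proj_xi p u v :
  torsion_tensor p (pi p u) (pi p v) = torsion_tensor p u v.
Proof.
have Lr w := torsion_tensor_linearr p w; have Ll w := torsion_tensor_linearl p w.
rewrite [in RHS](proj_xi_decomp p u) [in RHS](proj_xi_decomp p v).
rewrite [in RHS](linD (Ll _)) (linZ (Ll _)) torsion_tensor_reebl scaler0 addr0.
rewrite [in RHS](linD (Lr _)) (linZ (Lr _)).
by rewrite (torsion_tensorC p _ (X p)) torsion_tensor_reebl oppr0 scaler0 addr0.
Qed.

Lemma fun_smooth_at_lam_frame p v :
  fun_smooth_at (fun q => lam q (frame p v q) : R^o) p.
Proof.
apply: near_eq_fun_smooth_at (fun_smooth_at_lam_coord_field p v).
by apply: filterS (near_frame p v) => q ->.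
Qed.

Lemma proj_torsion_tensor_J p u : pi p (torsion_tensor p (J p u) u) = 0.
Proof.
have SF := vfield_at_frame p u; have Sl := fun_smooth_at_lam_frame p u.
have := ctc_torsion_xi triad_nabla (section_at_proj_xi SF Sl).
rewrite (_ : (fun q => J q _) = fun q => J q (frame p u q)); last first.
  by apply/funext => q; rewrite J_proj_xi.
rewrite (torsion_christoffel affine_nabla); last first.
- exact: vfield_at_proj_xi.
- apply: near_eq_section_at (vfield_at_J_coord_field p u).
  by apply: filterS (near_frame p u) => q ->.
rewrite !frame_id -/(torsion_tensor _ _ _).
by rewrite -[in X in _ -> X]torsion_tensor_proj_xi (proj_xi_id (lam_J p u)).
Qed.

(** In the Leibniz rule for v = pi v + lam(v) X, pi removes the term with the derivative of lam(v).
    The remaining lam(v) nabla_u X is the source of the two Reeb terms of the final formula. *)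
Lemma nabla_pi_frame p u v :
  nabla_pi lam X nabla (fun q => pi q (frame p v q)) p u
  = pi p (christoffel nabla p u v) - lam p v *: nabla X p u.
Proof.
have SF := vfield_at_frame p v; have Sl := fun_smooth_at_lam_frame p v.
have L := proj_xi_linear p.
rewrite /christoffel (nabla_proj_xi u SF Sl) (linD L) (linD L) !(linZ L).
rewrite proj_xi_reeb scaler0 add0r frame_id (proj_xi_id (lam_nabla_reeb p u)).
by rewrite addrK.
Qed.

End ContactTriad.

(** An alternating form on a plane is determined by its value on one basis, and [e 0], [j (e 0)] is
    a basis. *)
Lemma alternating_rV2_eq0 (R : realType) (V : lmodType R)
    (b : 'rV[R]_2 -> 'rV[R]_2 -> V) (j : 'rV[R]_2 -> 'rV[R]_2) u v :
  linear j -> (forall v, j (j v) = - v) ->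
  (forall u, linear (b u)) -> (forall u v, b u v = - b v u) ->
  (forall v, b v (j v) = 0) -> b u v = 0.
Proof.
move=> jL jj bL bA bj; pose e i : 'rV[R]_2 := delta_mx 0 i.
have bLl w : linear (b ^~ w).
  by move=> a x y; rewrite bA bL opprD -scalerN -!(bA _ w).
have bxx x : b x x = 0.
  have : 2%:R *: b x x = 0 by rewrite scaler_nat mulr2n {2}bA subrr.
  by move/eqP; rewrite scaler_eq0 pnatr_eq0 => /eqP.
pose a := j (e 0) 0 0; pose c := j (e 0) 0 1.
have rV2E (x : 'rV[R]_2) : x = x 0 0 *: e 0 + x 0 1 *: e 1.
  rewrite [LHS]row_sum_delta !big_ord_recl big_ord0 addr0.
  by congr (_ + _ *: delta_mx _ _); [congr (x _ _)|]; exact: val_inj.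
(* Otherwise [e 0] would be an eigenvector of [j] with a real eigenvalue [a] such that a a = -1. *)
have c0 : c != 0.
  apply/negP => /eqP c0.
  have jE : j (e 0) = a *: e 0 by rewrite [LHS]rV2E -/a -/c c0 scale0r addr0.
  have := jj (e 0); rewrite jE (linZ jL) jE scalerA => /rowP /(_ 0).
  rewrite !mxE eqxx mulr1 => aa.
  by have := sqr_ge0 a; rewrite expr2 aa ler0N1.
have b01 : b (e 0) (e 1) = 0.
  have /eqP := bj (e 0); rewrite [j (e 0)]rV2E (linD (bL _)) !(linZ (bL _)).
  by rewrite bxx scaler0 add0r scaler_eq0 (negPf c0) => /eqP.
rewrite (rV2E u) (rV2E v) (linD (bLl _)) !(linZ (bLl _)) !(linD (bL _)).
by rewrite !(linZ (bL _)) !bxx b01 (bA (e 1)) b01 oppr0 !(scaler0, addr0).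
Qed.

(** * Exterior covariant derivative of forms expanded in a pulled-back frame *)

Section ExteriorCovariantDerivative.
Variables (R : realType) (k m : nat) (S : manifold R k) (M : manifold R m).
Variables (w : S -> M) (E : M -> set 'rV[R]_m).
Variable D : (S -> 'rV[R]_m) -> S -> 'rV[R]_k -> 'rV[R]_m.
Variable dD : (S -> 'rV[R]_k -> 'rV[R]_m) -> S -> 'rV[R]_k -> 'rV[R]_k -> 'rV[R]_m.
Hypothesis smooth_w : smooth_map w.
Hypothesis extD : ext_cov_derivative w E D dD.
Hypothesis E0 : forall q, E q 0.
Hypothesis ED : forall q u v, E q u -> E q v -> E q (u + v).
Hypothesis EZ : forall q a u, E q u -> E q (a *: u).

Lemma vform1_at0 z : vform1_at w E (fun _ _ => 0) z.
Proof.
split=> [b a u v|v]; first by rewrite scaler0 addr0.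
split; last by apply: nearW => b; exact: E0.
rewrite (_ : local_rep _ _ _ = fun=> 0); first exact: smooth_at_cst.
by apply/funext => x; rewrite /local_rep /to_chart linear0.
Qed.

Lemma vform1_atD beta gamma z : vform1_at w E beta z -> vform1_at w E gamma z ->
  vform1_at w E (fun b v => beta b v + gamma b v) z.
Proof.
move=> [bL Sb] [gL Sg]; split=> [b a u v|v]; last exact: section_atD.
by rewrite bL gL scalerDr addrACA.
Qed.

Lemma vform1_at_sum (I : Type) (r : seq I) beta z :
  (forall i, vform1_at w E (beta i) z) ->
  vform1_at w E (fun b v => \sum_(i <- r) beta i b v) z.
Proof.
move=> Sb; elim: r => [|i r IH].
  rewrite (_ : (fun _ => _) = fun _ _ => 0); first exact: vform1_at0.
  by apply/funext => b; apply/funext => v; rewrite big_nil.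
rewrite (_ : (fun _ => _) = fun b v => beta i b v + \sum_(l <- r) beta l b v).
  exact: vform1_atD.
by apply/funext => b; apply/funext => v; rewrite big_cons.
Qed.

Lemma ext_cov_derivative_sum (I : Type) (r : seq I) beta z v1 v2 :
  (forall i, vform1_at w E (beta i) z) ->
  dD (fun b v => \sum_(i <- r) beta i b v) z v1 v2
  = \sum_(i <- r) dD (beta i) z v1 v2.
Proof.
move=> Sb; elim: r => [|i r IH].
  rewrite big_nil (_ : (fun _ => _) = fun _ _ => 0); last first.
    by apply/funext => b; apply/funext => v; rewrite big_nil.
  (* Additivity at 0 + 0 = 0 forces the value on the zero form to vanish. *)
  have := extD.1 _ _ _ (vform1_at0 z) (vform1_at0 z) v1 v2.
  rewrite (_ : (fun _ => _) = fun _ _ => 0); last first.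
    by apply/funext => b; apply/funext => v; rewrite addr0.
  by move/eqP; rewrite -subr_eq0 opprD addrA subrr sub0r oppr_eq0 => /eqP.
rewrite big_cons -IH.
rewrite (_ : (fun _ => _) = fun b v => beta i b v + \sum_(l <- r) beta l b v).
  by rewrite extD.1//; exact: vform1_at_sum.
by apply/funext => b; apply/funext => v; rewrite big_cons.
Qed.

(** The dw^i of the overview, in the chart at [w z]; the total [coframe] makes them defined on all
    of [S]. *)
Definition dcoord z i b v : R^o := coframe (w z) (w b) (dmap w b v) 0 i.

Lemma dcoord_linear z i : linear_fiberwise (dcoord z i).
Proof.
by move=> b a u v; rewrite /dcoord /dmap linearP coframe_is_linear !mxE.
Qed.

Let F z := chart (w z) \o w \o chartV z.

Lemma dcoord_coord_field z i v : \forall b \near z,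
  'd (F z) (chart z b) v 0 i = dcoord z i b (coord_field z v b).
Proof.
have [cw _] := smooth_w.
have n1 := near_dom (dom_base z).
have n2 := cw z _ (near_dom (dom_base (w z))).
apply: filterS2 n1 n2 => b zb wzb; rewrite /dcoord /coframe asboolT//.
by rewrite to_chart_dmap.
Qed.

Lemma fun_smooth_at_diff_chart z i v : let h x : R^o := 'd (F z) x v 0 i in
  fun_smooth_at (h \o chart z) z /\ forall u, dfun (h \o chart z) z u = 'd h (chart z z) u.
Proof.
move=> h; have Sh : smooth_at h (chart z z).
  by apply/smooth_at_coord/smooth_at_diff; case: smooth_w => _; apply.
have Eh : \forall x \near chart z z, h x = (h \o chart z \o chartV z) x.
  by apply: filterS (near_chart_image (dom_base z)) => x [_ /= ->].
split; first exact: near_eq_smooth_at Eh Sh.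
by move=> u; exact: near_eq_diffE Eh (smooth_at_differentiable Sh).
Qed.

Lemma form1_at_dcoord z i : form1_at (dcoord z i) z.
Proof.
move=> v; have [Sh _] := fun_smooth_at_diff_chart z i v.
exact: near_eq_fun_smooth_at (dcoord_coord_field z i v) Sh.
Qed.

(** Near [z] the form is the differential of the [i]-th coordinate of [w], so this is the equality
    of mixed second derivatives. *)
Lemma extd_dcoord z i v1 v2 : extd (dcoord z i) z v1 v2 = 0.
Proof.
rewrite /extd.
have [S1 D1] := fun_smooth_at_diff_chart z i v1.
have [S2 D2] := fun_smooth_at_diff_chart z i v2.
rewrite (near_eq_dfun v2 (dcoord_coord_field z i v1) S1) D1.
rewrite (near_eq_dfun v1 (dcoord_coord_field z i v2) S2) D2.
have SF : smooth_at (F z) (chart z z) by case: smooth_w => _; apply.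
by apply/eqP; rewrite subr_eq0; apply/eqP; exact: smooth_at_diffC.
Qed.

Lemma ext_cov_derivative_dcoord (Y : 'I_m -> M -> 'rV[R]_m) z v1 v2 :
  (forall i, section_at id E (Y i) (w z)) ->
  dD (fun b v => \sum_i dcoord z i b v *: Y i (w b)) z v1 v2
  = - \sum_i wedge (dcoord z i z) (D (Y i \o w) z) v1 v2.
Proof.
move=> SY.
have Ss i : section_at w E (Y i \o w) z by exact: section_at_pullback.
rewrite (@ext_cov_derivative_sum _ _ (fun i b v => dcoord z i b v *: (Y i \o w) b)).
  rewrite -sumrN; apply: eq_bigr => i _.
  rewrite extD.2//; [|exact: dcoord_linear|exact: form1_at_dcoord].
  by rewrite extd_dcoord scale0r sub0r.
move=> i; split=> [b a u v|v]; first by rewrite dcoord_linear scalerDl scalerA.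
apply: (section_atZ (h := fun b => dcoord z i b (coord_field z v b))) => //.
exact: form1_at_dcoord.
Qed.
End ExteriorCovariantDerivative.

(** * Comparison of the two sides on the pairs v, j v *)

Theorem theorem1p2 (R : realType) (n : nat) (M : manifold R n.*2.+1)
    (lam : M -> 'rV[R]_(n.*2.+1) -> R^o) (X : M -> 'rV[R]_(n.*2.+1))
    (J : M -> 'rV[R]_(n.*2.+1) -> 'rV[R]_(n.*2.+1))
    (nabla : (M -> 'rV[R]_(n.*2.+1)) -> M -> 'rV[R]_(n.*2.+1) ->
             'rV[R]_(n.*2.+1))
    (S : manifold R 2) (j : S -> 'rV[R]_2 -> 'rV[R]_2) (w : S -> M)
    (D : (S -> 'rV[R]_(n.*2.+1)) -> S -> 'rV[R]_2 -> 'rV[R]_(n.*2.+1))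
    (dD : (S -> 'rV[R]_2 -> 'rV[R]_(n.*2.+1)) -> S -> 'rV[R]_2 -> 'rV[R]_2 ->
          'rV[R]_(n.*2.+1))
    (triadM : contact_triad lam X J)
    (triad_nabla : contact_triad_connection lam X J nabla)
    (riemannS : riemann_surface j)
    (CRw : contact_CR_map lam X J j w)
    (pullD : pullback_connection w (contact_str lam)
               (nabla_pi lam X nabla) D)
    (extD : ext_cov_derivative w (contact_str lam) D dD) :
  forall (z : S) (v1 v2 : 'rV[R]_2),
    dD (dpi lam X w) z v1 v2
    = - wedge (fun v => pullback_form w lam z (j z v))
              (fun v => 2^-1 *: lie_endo X J (w z) (dpi lam X w z v)) v1 v2.
Proof.
move=> z v1 v2; have [smooth_w dbar0] := CRw.
have lamL := lam_linear triadM; have piL := proj_xi_linear triadM.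
have JL := J_linear triadM.
have nL p := nabla_reeb_linear triadM triad_nabla p.
have affine_nabla := ctc_affine triad_nabla.
set p := w z; pose P v := dmap w z v; pose u v := dpi lam X w z v.
have PL : linear P by move=> a x y; rewrite /P /dmap linearP.
have uL : linear u by move=> a x y; rewrite /u /dpi -/(P _) PL piL.
have jL : linear (j z) by case: riemannS => -[+ _] _; apply.
have jj v : j z (j z v) = - v by case: riemannS.
pose tw := torsion_tensor nabla p.
(* This formula holds for every smooth [w]; the Cauchy-Riemann equation enters only in [uj]
   below. *)
have dpiE v v' : dD (dpi lam X w) z v v' = proj_xi lam X p (tw (P v) (P v'))
    - lam p (P v') *: nabla X p (P v) + lam p (P v) *: nabla X p (P v').
  pose Y i q := proj_xi lam X q (frame p (delta_mx 0 i) q).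
  have SY i : section_at id (contact_str lam) (Y i) p.
    apply: (section_at_proj_xi triadM); first exact: vfield_at_frame.
    exact: (fun_smooth_at_lam_frame triadM).
  have -> : dpi lam X w = fun b v => \sum_i dcoord w z i b v *: Y i (w b).
    apply/funext => b; apply/funext => x; rewrite /dpi /Y.
    rewrite -{1}(frame_coframe p (w b) (dmap w b x)).
    rewrite (lin_rowE _ (frame_is_linear p (w b))) (linsum (piL _)).
    by apply: eq_bigr => i _; rewrite (linZ (piL _)).
  rewrite (ext_cov_derivative_dcoord smooth_w extD) //; first last.
  - by move=> q a x xq; rewrite /contact_str /= (linZ (lamL q)) xq scaler0.
  - by move=> q x y xq yq; rewrite /contact_str /= (linD (lamL q)) xq yq addr0.
  - by move=> q; rewrite /contact_str /= (lin0 (lamL q)).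
  (* [g x] is linear, so the sum over the frame of the dw^i (v) times [g x (delta_mx 0 i)]
     recombines into [g x (P v)]. *)
  pose g x y := proj_xi lam X p (christoffel nabla p x y) - lam p y *: nabla X p x.
  have gL x : linear (g x).
    move=> a y y'; rewrite /g (christoffel_linearr affine_nabla) piL lamL.
    by rewrite scalerDl opprD addrACA -scalerA -scalerBr.
  have DE i y : D (Y i \o w) z y = g (P y) (delta_mx 0 i).
    exact: etrans (pullD.2 (Y i) z y (SY i)) (nabla_pi_frame triadM triad_nabla _ _ _).
  transitivity (g (P v) (P v') - g (P v') (P v)).
    rewrite (lin_rowE (P v') (gL _)) (lin_rowE (P v) (gL _)) -sumrB -sumrN.
    by apply: eq_bigr => i _; rewrite /wedge !DE /dcoord !coframe_id opprB.
  have E (a b c d : 'rV[R]_(n.*2.+1)) : a - b - (c - d) = a - c - b + d.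
    by rewrite opprB addrA [LHS]addrAC (addrAC a).
  by rewrite /g /tw /torsion_tensor (linB (piL p)); exact: E.
(* The left-hand side minus the right-hand side; it is shown to be alternating and to vanish on all
   pairs x, j x. *)
pose b x y := dD (dpi lam X w) z x y +
  wedge (fun v => pullback_form w lam z (j z v))
        (fun v => 2^-1 *: lie_endo X J p (u v)) x y.
have nPu v : nabla X p (P v) = nabla X p (u v).
  by rewrite -(nabla_reeb_proj_xi triadM triad_nabla).
(* The equation says u = - J u j; applying J, which squares to minus the identity on xi, gives
   complex linearity. *)
have uj v : u (j z v) = J p (u v).
  have /eqP := dbar0 z v; rewrite /dbar_pi scaler_eq0 invr_eq0 pnatr_eq0 /=.
  rewrite -/(u v) -/(u (j z v)) -/p addr_eq0 => /eqP ->.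
  rewrite (linN (JL p)) (JJ triadM) ?opprK//.
  exact: (lam_proj_xi triadM).
pose N v := nabla X p (u v); pose K v := J p (N v).
pose t x y := proj_xi lam X p (tw (P x) (P y)).
pose l v : R := lam p (P v); pose lj v : R := l (j z v).
have bE x y : b x y = t x y - l y *: N x + l x *: N y
    + (lj x *: K y - lj y *: K x).
  rewrite /b dpiE !nPu /wedge !(half_lie_endo_J triadM triad_nabla).
  by rewrite /pullback_form -/p -!/(P _).
have NL : linear N by move=> a x y; rewrite /N uL nL.
have KL : linear K by move=> a x y; rewrite /K NL JL.
have lL a x y : l (a *: x + y) = a * l x + l y by rewrite /l PL lamL.
have ljL a x y : lj (a *: x + y) = a * lj x + lj y by rewrite /lj jL lL.
have tL x : linear (t x).
  move=> a y y'; rewrite /t /tw PL (torsion_tensor_linearr triad_nabla) piL //.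
have tA x y : t x y = - t y x by rewrite /t /tw torsion_tensorC (linN (piL p)).
suff : b v1 v2 = 0 by move/eqP; rewrite addr_eq0 => /eqP.
apply: (alternating_rV2_eq0 _ _ jL jj) => [x a y y'|x y|x]; rewrite !bE.
- rewrite tL lL NL KL ljL; move: (t x y) (t x y') (N x) (N y) (N y') (K x) (K y) (K y').
  by move=> *; apply/rowP => i; rewrite !mxE; ring.
- rewrite (tA y x); move: (t x y) (N x) (N y) (K x) (K y).
  by move=> *; apply/rowP => i; rewrite !mxE; ring.
- have ux0 : lam p (u x) = 0 by exact: (lam_proj_xi triadM).
  have -> : t x (j z x) = 0.
    rewrite /t /tw -(torsion_tensor_proj_xi triadM triad_nabla).
    rewrite -[proj_xi lam X p (P x)]/(u x) -[proj_xi lam X p (P (j z x))]/(u (j z x)).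
    rewrite uj torsion_tensorC.
    by rewrite (linN (piL p)) (proj_torsion_tensor_J triadM triad_nabla) oppr0.
  (* The substitutions K x = - N (j x), K (j x) = N x and lj (j x) = - l x make the four remaining
     terms cancel in pairs. *)
  have -> : K x = - N (j z x).
    by rewrite /K /N uj (nabla_reeb_J triadM triad_nabla).
  have -> : K (j z x) = N x.
    rewrite /K /N uj (nabla_reeb_J triadM triad_nabla) (JJ triadM)//.
    by rewrite (linN (nL p)) opprK.
  have -> : lj (j z x) = - l x by rewrite /lj jj /l (linN PL) (linN (lamL p)).
  rewrite /lj; move: (N x) (N (j z x)) (l (j z x)) (l x).
  by move=> *; apply/rowP => i; rewrite !mxE; ring.
Qed.
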